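(* Let $G$ be a finite graph with vertex set $V=[n]$, let $P_{G,Q}$ be a symmetric graphical channel with graph $G$, and let $(X,Y)$ be a binary synchronization instance drawn from $P_{G,Q}$. Then for all distinct $u,v\in V$, $$I_2\big(X_u;X_v\mid (Y_e)_{e\in E(G)}\big)\le\sum_{\pi\in\Gamma_G(u,v)} I_2\big(X_u;X_v\mid (Y_e)_{e\in E(\pi)}\big),$$ where $\Gamma_G(u,v)$ denotes the set of paths (self-avoiding walks) from $u$ to $v$ in $G$.
   Context: Graphical channel. Let $G=(V,E(G))$ be a finite graph with $V=[n]=\{1,\dots,n\}$. For each edge $e$, an edge channel $Q_e(\cdot\mid\cdot)$ has input alphabet $\{-1,+1\}$ and output in a measurable space $(\mathcal{Y}_e,\mathcal{A}_e)$; that is, $Q_e(\cdot\mid+1)$ and $Q_e(\cdot\mid-1)$ are probability measures on $(\mathcal{Y}_e,\mathcal{A}_e)$. For $x\in\{-1,+1\}^V$ and $e=(i,j)$ put $x_e=x_i\cdot x_j$. The graphical channel $P_{G,Q}$ has input alphabet $\{-1,+1\}^V$ and output alphabet $\prod_{e\in E(G)}\mathcal{Y}_e$, and is determined by $P_{G,Q}(\prod_e A_e\mid x)=\prod_{e\in E(G)}Q_e(A_e\mid x_e)$ for $A_e\in\mathcal{A}_e$. Binary synchronization instance. $X$ is uniform on $\{-1,+1\}^V$, and $Y=(Y_e)_{e\in E(G)}$ is the output of $X$ through $P_{G,Q}$. Symmetry. An edge channel $Q_e$ is symmetric if there is a measurable map $T_e:\mathcal{Y}_e\to\mathcal{Y}_e$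 with $T_e=T_e^{-1}$ and $Q_e(A\mid+1)=Q_e(T_e(A)\mid-1)$ for all $A\in\mathcal{A}_e$. The graphical channel is symmetric if every edge channel is symmetric. $\chi^2$-mutual information. For random variables $A,B$ with joint law $\nu_{A,B}\ll\nu_A\times\nu_B$, $I_2(A;B)=\int\left(\frac{d\nu_{A,B}}{d(\nu_A\times\nu_B)}-1\right)^2 d(\nu_A\times\nu_B)$. The conditional version $I_2(A;B\mid C)$ is the expectation over $C$ of the $\chi^2$-mutual information of the conditional joint law of $(A,B)$ given $C$. For a path $\pi$, $E(\pi)$ denotes its set of edges. *)

(* Defs.v *)
From HB Require Import structures.
From mathcomp Require Import all_boot all_order all_algebra.
From mathcomp Require Import all_classical all_reals all_analysis.
From mathcomp Require Import measurable_realfun.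

Set Implicit Arguments.
Unset Strict Implicit.
Unset Printing Implicit Defensive.

Import Order.TTheory GRing.Theory Num.Theory.
Import numFieldNormedType.Exports.
Local Open Scope classical_set_scope.
Local Open Scope ring_scope.

Section product_space.
Context (I : Type) (d : I -> measure_display)
  (T : forall i, measurableType (d i)).

Definition cylinders : set (set (forall i, T i)) :=
  [set B | exists i (A : set (T i)), measurable A /\ B = [set f | A (f i)]].

Definition product_space := g_sigma_algebraType cylinders.

Lemma measurable_fun_product_space d' (S : measurableType d')
    (h : S -> product_space) :
  (forall i, measurable_fun [set: S] (fun s => h s i)) ->
  measurable_fun [set: S] h.
Proof.
move=> mh; apply: (@measurability _ _ S product_space setT h cylinders) => //.
move=> _ [_ [i [A [mA ->]]] <-]; exact: mh.
Qed.

Lemma measurable_coordinate i :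
  measurable_fun [set: product_space] (fun f : product_space => f i).
Proof.
by move=> _ A mA; rewrite setTI; apply: sub_sigma_algebra; exists i, A.
Qed.

End product_space.

(* Given y = (y_i)_i, [subfamily S y] is (y_i)_{i in S}. *)
Section subfamily.
Context (I : finType) (d : I -> measure_display)
  (T : forall i, measurableType (d i)) (S : {set I}).

Definition subproduct_space :=
  product_space (fun s : {i : I | i \in S} => T (val s)).

Definition subfamily (y : product_space T) : subproduct_space :=
  fun s => y (val s).

Lemma measurable_subfamily : measurable_fun [set: product_space T] subfamily.
Proof.
by apply: measurable_fun_product_space => s; exact: measurable_coordinate.
Qed.

HB.instance Definition _ :=
  isMeasurableFun.Build _ _ _ _ subfamily measurable_subfamily.

End subfamily.
Arguments subfamily {I d T} S y _.

Section projections.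
Context d1 d2 (T1 : measurableType d1) (T2 : measurableType d2).

HB.instance Definition _ :=
  isMeasurableFun.Build _ _ _ _ (@fst T1 T2) measurable_fst.
HB.instance Definition _ :=
  isMeasurableFun.Build _ _ _ _ (@snd T1 T2) measurable_snd.

End projections.

Section chi2_information.
Local Open Scope ereal_scope.
Local Open Scope charge_scope.
Context (R : realType).

(* If [nu] is not dominated by the product of its marginals, the library's
   Radon-Nikodym derivative is -oo everywhere, so that the value is +oo. *)
Definition chi2_info d1 d2 (T1 : measurableType d1) (T2 : measurableType d2)
    (nu : probability (T1 * T2)%type R) : \bar R :=
  let mu : probability (T1 * T2)%type R :=
    distribution nu (@fst T1 T2) \x distribution nu (@snd T1 T2) in
  \int[mu]_z (('d (charge_of_finite_measure nu) '/d mu) z - 1) ^+ 2.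

Context d (Omega : measurableType d) (P : probability Omega R).

Definition is_conditional_law d1 d2 (T1 : measurableType d1)
    (T2 : measurableType d2) (Z : {RV P >-> T1}) (C : {RV P >-> T2})
    (kappa : T2 -> probability T1 R) : Prop :=
  (forall D, measurable D -> measurable_fun [set: T2] (kappa ^~ D)) /\
  (forall D E, measurable D -> measurable E ->
     P (Z @^-1` D `&` C @^-1` E) = \int[distribution P C]_(c in E) kappa c D).

Context d1 d2 d3 (T1 : measurableType d1) (T2 : measurableType d2)
  (T3 : measurableType d3).
Context (A : {RV P >-> T1}) (B : {RV P >-> T2}) (C : {RV P >-> T3}).

Definition pair_RV (w : Omega) : T1 * T2 := (A w, B w).

Lemma measurable_pair_RV : measurable_fun [set: Omega] pair_RV.
Proof. by apply: measurable_fun_pair. Qed.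

HB.instance Definition _ :=
  isMeasurableFun.Build _ _ _ _ pair_RV measurable_pair_RV.

(* When A and B take values in finite discrete spaces, a version [kappa] of the
   conditional law of (A, B) given C exists and the expectation does not depend
   on it. In general the value is +oo if there is no version. *)
Definition cond_chi2_info : \bar R :=
  xget +oo [set r | exists kappa : T3 -> probability (T1 * T2)%type R,
    is_conditional_law pair_RV C kappa /\
    r = \int[distribution P C]_c chi2_info (kappa c)].

End chi2_information.

Record sgraph (n : nat) := SGraph {
  edges : {set {set 'I_n}} ;
  edges_card2 : forall e, e \in edges -> #|e| = 2
}.

Section graph.
Context (n : nat) (G : sgraph n).

Definition edge := {e : {set 'I_n} | e \in edges G}.

Definition adj_rel : rel 'I_n := fun i j => [set i; j]%SET \in edges G.

(* A path from u to v is encoded by the sequence [p] of its vertices after the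
   initial vertex u. It is repetition-free, hence of size at most n. *)
Definition is_path (u v : 'I_n) (p : seq 'I_n) : bool :=
  [&& path adj_rel u p, last u p == v & uniq (u :: p)].

Definition path_edges (u : 'I_n) (p : seq 'I_n) : {set edge} :=
  [set e : edge | val e \in pairmap (fun i j => [set i; j]%SET) u p]%SET.

End graph.

Section graphical_channel.
Local Open Scope ereal_scope.
Context (R : realType) (n : nat) (G : sgraph n).
Context (d : edge G -> measure_display) (Y : forall e, measurableType (d e)).

(* The alphabet {-1, +1} is [bool], where [b] stands for the sign (-1) ^+ b:
   false is +1, true is -1, and multiplication of signs is [addb]. *)
Definition edge_spin (x : {ffun 'I_n -> bool}) (e : edge G) : bool :=
  \big[addb/false]_(i in val e) x i.

Definition edge_channels := forall e : edge G, bool -> probability (Y e) R.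

Definition is_graphical_channel (Q : edge_channels)
    (PGQ : {ffun 'I_n -> bool} -> probability (product_space Y) R) : Prop :=
  forall x (A : forall e, set (Y e)), (forall e, measurable (A e)) ->
    PGQ x [set y | forall e, A e (y e)] =
    \prod_(e : edge G) Q e (edge_spin x e) (A e).

Definition symmetric_channel d' (Z : measurableType d')
    (q : bool -> probability Z R) : Prop :=
  exists T : Z -> Z, [/\ measurable_fun [set: Z] T, involutive T &
    forall A, measurable A -> q false A = q true (T @` A)].

(* X is uniform on {-1, +1}^V and Y is the output of X through [PGQ]. *)
Definition is_synchronization_instance
    (PGQ : {ffun 'I_n -> bool} -> probability (product_space Y) R)
    d' (Omega : measurableType d') (P : probability Omega R)
    (X : 'I_n -> {RV P >-> bool}) (Yv : {RV P >-> product_space Y}) : Prop :=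
  forall (x : {ffun 'I_n -> bool}) (B : set (product_space Y)), measurable B ->
    P ([set w | forall i, X i w = x i] `&` Yv @^-1` B) =
    ((2 ^+ n)^-1)%:E * PGQ x B.

(* The observations (Y_e)_{e in S}. *)
Definition observed d' (Omega : measurableType d') (P : probability Omega R)
    (Yv : {RV P >-> product_space Y}) (S : {set edge G}) :
    {RV P >-> subproduct_space Y S} :=
  subfamily S \o Yv.

End graphical_channel.

(* Main.v *)
(** Given the output, the posterior of [X] is invariant under the global flip, so
    the information between [X_u] and [X_v] is the mean square of the posterior
    correlation. Let [M] be the product over the edges of the means of the two
    output laws, and [1 + s * theta_e] the density of [Q_e(. | s)]. With [Z] and
    [N] the averages over [x] of [prod_e (1 + x_e * theta_e)] and of
    [x_u * x_v * prod_e (1 + x_e * theta_e)], the correlation is [N / Z] and the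
    information is the integral of [N ^ 2 / Z] against [M].

    By symmetry of the channels the signs of the [theta_e] may be averaged out.
    For each edge in turn, the average over the sign of [theta_e] is at most the
    value for an erasure coupling: 0 with probability [1 - theta_e ^ 2] and a
    uniform sign otherwise. Once all couplings are in {-1, 0, 1}, [N] vanishes
    unless the support connects [u] to [v], and [N ^ 2 / Z <= Z] in any case; a
    union bound over the paths gives the sum of the [prod_e theta_e ^ 2]. If only
    the edges of a path are observed then [Z = 1] and [N = prod_e theta_e], so
    these products integrate exactly to the informations along the paths. *)
Require Import Defs.
From HB Require Import structures.
From mathcomp Require Import all_boot all_order all_algebra.
From mathcomp Require Import all_classical all_reals all_analysis.
From mathcomp Require Import measurable_realfun ring lra.

Set Implicit Arguments.
Unset Strict Implicit.
Unset Printing Implicit Defensive.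
Import Order.TTheory GRing.Theory Num.Theory.
Import numFieldNormedType.Exports.
Local Open Scope classical_set_scope.
Local Open Scope ring_scope.

(** * Updates at one coordinate and a two-point inequality *)

Section update.
Context (I : eqType) (V : Type).
Implicit Types (t : I -> V) (i j : I) (a b : V).

Definition update t i a : I -> V := fun j => if j == i then a else t j.

Lemma updateC t i j a b : i != j ->
  update (update t i a) j b = update (update t j b) i a.
Proof.
move=> ij; apply/funext => k; rewrite /update /=.
by have [->|] := eqVneq k j; rewrite /= 1?eq_sym ?(negPf ij).
Qed.

Lemma update_id t i : update t i (t i) = t.
Proof. by apply/funext => k; rewrite /update; case: eqP => [->|]. Qed.

End update.

(* Both sides differ from the chord [(p ^+ 2 / P + q ^+ 2 / Q) / 2] by multiples
   of [(p * Q - q * P) ^+ 2], which reduces the claim to the convexity of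
   [x^-1]. *)
Lemma chi2_erasure_le (R : realFieldType) (p q P Q a : R)
    (N := fun c => (1 + c) / 2 * p + (1 - c) / 2 * q)
    (Z := fun c => (1 + c) / 2 * P + (1 - c) / 2 * Q) :
  `|p| <= P -> `|q| <= Q -> `|a| <= 1 ->
  (N a ^+ 2 / Z a + N (- a) ^+ 2 / Z (- a)) / 2 <=
  (1 - a ^+ 2) * (N 0 ^+ 2 / Z 0) + a ^+ 2 * ((p ^+ 2 / P + q ^+ 2 / Q) / 2).
Proof.
move=> pP qQ a1.
have P0 : 0 <= P by apply: le_trans pP.
have Q0 : 0 <= Q by apply: le_trans qQ.
have scaled (c x y : R) : (c * x) ^+ 2 / (c * y) = c * (x ^+ 2 / y).
  have [->|c0] := eqVneq c 0; first by rewrite !mul0r expr0n mul0r.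
  have [->|y0] := eqVneq y 0; first by rewrite !mulr0 !invr0 !mulr0.
  by field; rewrite ?c0 ?y0.
(* [P = 0] forces [p = 0], and both sides then equal [w / 2]. The case [Q = 0] is the mirror
   image. *)
have [PE|Pneq] := eqVneq P 0.
  have pE : p = 0 by apply/eqP; rewrite -normr_le0 -PE.
  rewrite /N /Z pE PE !mulr0 !add0r !scaled.
  rewrite le_eqVlt; apply/orP; left; apply/eqP; rewrite invr0 mulr0; set w := q ^+ 2 / Q.
  by field.
have [QE|Qneq] := eqVneq Q 0.
  have qE : q = 0 by apply/eqP; rewrite -normr_le0 -QE.
  rewrite /N /Z qE QE !mulr0 !addr0 !scaled.
  rewrite le_eqVlt; apply/orP; left; apply/eqP; rewrite invr0 mulr0; set w := p ^+ 2 / P.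
  by field.
have Pgt : 0 < P by rewrite lt0r Pneq.
have Qgt : 0 < Q by rewrite lt0r Qneq.
have Zpos (c : R) : `|c| <= 1 -> 0 < Z c.
  rewrite ler_norml => /andP[c1 c2]; rewrite /Z.
  have [->|c0] := eqVneq c 1.
    by rewrite subrr mul0r mul0r addr0 mulr_gt0// divr_gt0//; lra.
  apply: ltr_wpDl; first by apply: mulr_ge0 => //; lra.
  by rewrite mulr_gt0// divr_gt0// subr_gt0 lt_neqAle c0.
have chord (c : R) : `|c| <= 1 -> N c ^+ 2 / Z c = (1 + c) / 2 * (p ^+ 2 / P) +
    (1 - c) / 2 * (q ^+ 2 / Q) -
    (1 - c ^+ 2) / 4 * ((p * Q - q * P) ^+ 2 / (P * Q)) / Z c.
  move=> /Zpos; rewrite /N /Z => /lt0r_neq0 Zc; field.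
  rewrite Pneq Qneq !andbT; apply: contra_neq Zc => Zc.
  by rewrite -(mul0r 2^-1) -Zc; field.
have aN1 : `|- a| <= 1 by rewrite normrN.
have za : `|0 : R| <= 1 by rewrite normr0.
rewrite (chord _ a1) (chord _ aN1) (chord _ za).
set w1 := p ^+ 2 / P; set w2 := q ^+ 2 / Q; set D := (_ ^+ 2 / (P * Q)).
have D0 : 0 <= D by rewrite divr_ge0 ?sqr_ge0// mulr_ge0.
have Zm : Z 0 = (Z a + Z (- a)) / 2 by rewrite /Z; field.
have x0 := Zpos _ a1; have y0 := Zpos _ aN1.
have inv_convex : (Z 0)^-1 <= ((Z a)^-1 + (Z (- a))^-1) / 2.
  rewrite Zm; move: (Z a) (Z (- a)) x0 y0 => x y x0 y0.
  rewrite -subr_ge0 (_ : _ - _ = (x - y) ^+ 2 / (2 * x * y * (x + y))).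
    have [x1 y1] := (ltW x0, ltW y0).
    by rewrite divr_ge0 ?sqr_ge0// !mulr_ge0 ?addr_ge0.
  by field; rewrite !gt_eqF ?addr_gt0.
have a2 : 0 <= 1 - a ^+ 2.
  by rewrite subr_ge0 -(real_normK (num_real a)) expr_le1.
rewrite -subr_ge0 (_ : _ - _ = (1 - a ^+ 2) / 4 * D *
    (((Z a)^-1 + (Z (- a))^-1) / 2 - (Z 0)^-1)); last first.
  have /lt0r_neq0 := Zpos _ za; have /lt0r_neq0 := x0; have /lt0r_neq0 := y0.
  move: (Z a) (Z (- a)) (Z 0) => x y z y_neq0 x_neq0 z_neq0.
  by move: w1 w2 D {D0} => w1 w2 D; field; rewrite x_neq0 y_neq0 z_neq0.
by rewrite mulr_ge0 ?subr_ge0// mulr_ge0// divr_ge0.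
Qed.

(** * Ising partition functions *)

Section ising.
Context (R : realFieldType) (n : nat) (G : sgraph n).
Local Notation config := {ffun 'I_n -> bool}.
Implicit Types (x : config) (t : edge G -> R) (e : edge G) (u v : 'I_n).

(* The coupling [t e] stands for theta_e(y_e), where [1 + s * theta_e] is the
   density of [Q_e(. | s)] with respect to the mean of the two output laws. *)
Definition likelihood x t : R := \prod_e (1 + (-1) ^+ edge_spin x e * t e).

Definition evidence t : R := (2 ^+ n)^-1 * \sum_(x : config) likelihood x t.

Definition correlator u v t : R :=
  (2 ^+ n)^-1 * \sum_(x : config) (-1) ^+ (x u (+) x v) * likelihood x t.

Definition chi2_integrand u v t : R := correlator u v t ^+ 2 / evidence t.

Lemma spin_coupling_ge0 (b : bool) (c : R) : `|c| <= 1 -> 0 <= 1 + (-1) ^+ b * c.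
Proof. by rewrite ler_norml => /andP[? ?]; case: b; rewrite /= ?expr0 ?expr1; lra. Qed.

Lemma likelihood_ge0 x t : (forall e, `|t e| <= 1) -> 0 <= likelihood x t.
Proof. by move=> t1; apply: prodr_ge0 => e _; exact: spin_coupling_ge0. Qed.

Lemma evidence_ge0 t : (forall e, `|t e| <= 1) -> 0 <= evidence t.
Proof.
move=> t1; rewrite mulr_ge0 ?invr_ge0 ?exprn_ge0//.
by apply: sumr_ge0 => x _; exact: likelihood_ge0.
Qed.

Lemma norm_correlator_le u v t : (forall e, `|t e| <= 1) ->
  `|correlator u v t| <= evidence t.
Proof.
move=> t1; rewrite normrM ger0_norm ?invr_ge0 ?exprn_ge0// ler_wpM2l//.
apply: le_trans (ler_norm_sum _ _ _) _; apply: ler_sum => x _.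
by rewrite normrMsign ger0_norm// likelihood_ge0.
Qed.

Lemma likelihood_updateE x t e c : likelihood x (update t e c) =
  (1 + (-1) ^+ edge_spin x e * c) *
  \prod_(i | i != e) (1 + (-1) ^+ edge_spin x i * t i).
Proof.
rewrite /likelihood (bigD1 e)//= {1}/update eqxx; congr (_ * _).
by apply: eq_bigr => i /negPf ie; rewrite /update ie.
Qed.

(** Each factor of the likelihood is affine in its own coupling, so the value at [c] interpolates
    between those at 1 and -1. Evidence and correlator inherit this. *)
Lemma likelihood_update x t e c : likelihood x (update t e c) =
  (1 + c) / 2 * likelihood x (update t e 1) +
  (1 - c) / 2 * likelihood x (update t e (-1)).
Proof.
rewrite !likelihood_updateE; move: (\prod_(i | _) _) => K.
by case: (edge_spin x e); rewrite /= ?expr0 ?expr1; field.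
Qed.

Lemma evidence_update t e c : evidence (update t e c) =
  (1 + c) / 2 * evidence (update t e 1) +
  (1 - c) / 2 * evidence (update t e (-1)).
Proof.
rewrite /evidence; under eq_bigr do rewrite likelihood_update.
by rewrite big_split/= -!mulr_sumr; ring.
Qed.

Lemma correlator_update u v t e c : correlator u v (update t e c) =
  (1 + c) / 2 * correlator u v (update t e 1) +
  (1 - c) / 2 * correlator u v (update t e (-1)).
Proof.
rewrite /correlator; under eq_bigr do rewrite likelihood_update mulrDr.
rewrite big_split/= mulrDr; congr (_ + _); rewrite mulrCA; congr (_ * _);
  rewrite mulr_sumr; apply: eq_bigr => x _; ring.
Qed.

Lemma sum_spin_flip (f : config -> R) (C : {set 'I_n}) :
  \sum_(x : config) f x = \sum_(x : config) f [ffun i => x i (+) (i \in C)].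
Proof.
rewrite [LHS](reindex_inj (h := fun x => [ffun i => x i (+) (i \in C)]))//.
by apply: (can_inj (g := fun x => [ffun i => x i (+) (i \in C)])) => x;
  apply/ffunP => i; rewrite !ffunE addbK.
Qed.

Lemma edge_spin2 x e i j : i != j -> val e = [set i; j]%SET ->
  edge_spin x e = x i (+) x j.
Proof. by move=> ij eE; rewrite /edge_spin eE big_setU1 ?inE//= big_set1. Qed.

Lemma edgeP e : exists i j, i != j /\ val e = [set i; j]%SET.
Proof.
have /eqP/cards2P[i [j [ij eE]]] := edges_card2 (valP e).
by exists i, j.
Qed.

(** An edge with nonzero coupling has both ends in [C] or both outside, so its spin product survives
    the flip. An edge with coupling 0 contributes the factor 1 either way. *)
Lemma likelihood_flip x t (C : {set 'I_n}) :
  (forall e i j, val e = [set i; j]%SET -> t e != 0 -> (i \in C) = (j \in C)) ->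
  likelihood [ffun i => x i (+) (i \in C)] t = likelihood x t.
Proof.
move=> tC; apply: eq_bigr => e _.
have [->|te] := eqVneq (t e) 0; first by rewrite !mulr0.
have [i [j [ij eE]]] := edgeP e.
rewrite !(edge_spin2 _ ij eE) !ffunE (tC _ _ _ eE te).
by rewrite addbACA addbb addbF.
Qed.

Lemma evidence0 : evidence (fun=> 0) = 1.
Proof.
have E x : likelihood x (fun=> 0) = 1.
  by rewrite /likelihood big1// => e _; rewrite mulr0 addr0.
rewrite /evidence; under eq_bigr do rewrite E.
rewrite sumr_const card_ffun card_bool card_ord natrX mulVf//.
Qed.

Definition erase (r : seq (edge G)) t : edge G -> R :=
  fun e => if e \in r then 0 else t e.

Lemma norm_update_le1 t e c : (forall e, `|t e| <= 1) -> `|c| <= 1 ->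
  forall e', `|update t e c e'| <= 1.
Proof. by move=> t1 c1 e'; rewrite /update; case: ifP. Qed.

Lemma erase_update r t e c : e \notin r ->
  erase r (update t e c) = update (erase r t) e c.
Proof.
move=> er; apply/funext => e'; rewrite /erase /update.
by have [->|//] := eqVneq e' e; rewrite (negPf er).
Qed.

Lemma erase_cons e r t : erase (e :: r) t = update (erase r t) e 0.
Proof.
by apply/funext => e'; rewrite /erase /update inE; case: (e' == e).
Qed.

(** The law of the couplings under the mean output law is invariant under reversing the sign of one
    coupling, so this averaging will leave integrals unchanged. *)
Definition sign_mean e (F : (edge G -> R) -> R) t : R :=
  (F t + F (update t e (- t e))) / 2.

Definition sign_means r F := foldr sign_mean F r.

Lemma sign_mean_evidence e t : sign_mean e evidence t = evidence (update t e 0).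
Proof.
rewrite /sign_mean -{1}(update_id t e) evidence_update.
by rewrite (evidence_update t e (- t e)) (evidence_update t e 0); field.
Qed.

Lemma sign_mean_correlator u v e t :
  sign_mean e (correlator u v) t = correlator u v (update t e 0).
Proof.
rewrite /sign_mean -{1}(update_id t e) correlator_update.
by rewrite (correlator_update u v t e (- t e)) (correlator_update u v t e 0); field.
Qed.

(** A function affine in the coupling of [e] averages over its sign to the value at coupling 0,
    which is what the hypothesis on [F] records. Distinct edges carry distinct couplings, so the
    averages can be taken one after the other. *)
Lemma sign_means_erase r F t : uniq r ->
  (forall e t, sign_mean e F t = F (update t e 0)) ->
  sign_means r F t = F (erase r t).
Proof.
move=> + FE; elim: r t => [|e r IH] t //= /andP[er ur].
rewrite [LHS]/sign_mean !IH// erase_update// erase_cons -FE /sign_mean.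
by rewrite [erase r t e]/erase (negPf er).
Qed.

Lemma sign_means_update r F t e c : e \notin r ->
  sign_means r F (update t e c) =
  sign_means r (fun t' => F (update t' e c)) t.
Proof.
elim: r t => [//|e' r IH] t; rewrite inE negb_or => /andP[ee' er] /=.
rewrite /sign_mean (updateC _ _ _ ee') !IH//.
by rewrite [update t e c e']/update eq_sym (negPf ee').
Qed.

Lemma sign_means_le r F1 F2 t : (forall e, `|t e| <= 1) ->
  (forall t', (forall e, `|t' e| <= 1) -> F1 t' <= F2 t') ->
  sign_means r F1 t <= sign_means r F2 t.
Proof.
move=> + F12; elim: r t => [|e r IH] t t1 /=; first exact: F12.
rewrite /sign_mean ler_wpM2r ?invr_ge0// lerD// IH//.
by apply: norm_update_le1; rewrite ?normrN.
Qed.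

Lemma sign_meansD r F1 F2 t :
  sign_means r (F1 \+ F2) t = sign_means r F1 t + sign_means r F2 t.
Proof. by elim: r t => [//|e r IH] t /=; rewrite /sign_mean !IH; field. Qed.

Lemma sign_meansZ r a F t :
  sign_means r (fun t => a * F t) t = a * sign_means r F t.
Proof. by elim: r t => [//|e r IH] t /=; rewrite /sign_mean !IH; field. Qed.

(* Replacing a coupling of random sign by an erasure coupling, which is 0 with
   probability [1 - t e ^+ 2] and otherwise a uniform sign, loses no
   information. *)
Lemma sign_means_chi2_erasure u v r t e : e \notin r ->
  (forall e, `|t e| <= 1) ->
  sign_means (e :: r) (chi2_integrand u v) t <=
  (1 - t e ^+ 2) * sign_means r (chi2_integrand u v) (update t e 0) +
  t e ^+ 2 * ((sign_means r (chi2_integrand u v) (update t e 1) +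
               sign_means r (chi2_integrand u v) (update t e (-1))) / 2).
Proof.
move=> er t1; set F := chi2_integrand u v.
(* [at_ c] freezes the coupling of [e] at [c]. Since [e] is not in [r], all terms become averages
   over the same signs, and their integrands can be compared pointwise. *)
pose at_ c t' := F (update t' e c).
have atE c : sign_means r F (update t e c) = sign_means r (at_ c) t.
  exact: sign_means_update.
rewrite [leLHS]/= /sign_mean -/(sign_means r F).
rewrite -[X in X + _](_ : sign_means r (at_ (t e)) t = _); last first.
  by rewrite -atE update_id.
rewrite !atE; move: (t e) (t1 e) => a a1.
rewrite [leLHS](_ : _ =
    sign_means r (fun t' => 2^-1 * (at_ a \+ at_ (- a)) t') t); last first.
  by rewrite sign_meansZ sign_meansD mulrC.
rewrite [leRHS](_ : _ =
    sign_means r ((fun t' => (1 - a ^+ 2) * at_ 0 t') \+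
                  (fun t' => a ^+ 2 / 2 * (at_ 1 \+ at_ (-1)) t')) t); last first.
  rewrite sign_meansD (sign_meansZ r (1 - a ^+ 2) (at_ 0)).
  rewrite (sign_meansZ r (a ^+ 2 / 2) (at_ 1 \+ at_ (-1))) sign_meansD.
  by rewrite -mulrA [2^-1 * _]mulrC.
(* Pointwise this is [chi2_erasure_le], with [p], [q] the correlators and [P], [Q] the evidences at
   coupling 1 and -1 of [e]. *)
apply: sign_means_le => // t' t1'; rewrite /at_ /F /chi2_integrand /=.
rewrite mulrC -[a ^+ 2 / 2 * _]mulrA [2^-1 * _]mulrC.
rewrite (evidence_update t' e a) (evidence_update t' e 0).
rewrite (evidence_update t' e (- a)) (correlator_update u v t' e a).
rewrite (correlator_update u v t' e 0) (correlator_update u v t' e (- a)).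
by apply: chi2_erasure_le => //; apply: norm_correlator_le;
  apply: norm_update_le1 => //; rewrite ?normrN1 ?normr1.
Qed.

End ising.

(** * Paths in the support of the couplings *)

Section paths.
Context (R : realFieldType) (n : nat) (G : sgraph n).
Local Notation config := {ffun 'I_n -> bool}.
Implicit Types (x : config) (t : edge G -> R) (e : edge G) (u v w : 'I_n).

(** [C] is a union of connected components of the graph formed by the edges with nonzero
    coupling. *)
Definition saturated t (C : {set 'I_n}) :=
  forall e i j, val e = [set i; j]%SET -> t e != 0 -> (i \in C) = (j \in C).

(** Flipping the spins in [C] preserves the likelihood and negates the product of the spins at [u]
    and [v], so the sum equals its opposite. *)
Lemma correlator_eq0 u v t (C : {set 'I_n}) :
  saturated t C -> u \in C -> v \notin C -> correlator u v t = 0.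
Proof.
move=> tC uC vC; rewrite /correlator; set S := \sum_(x : config) _.
suff SN : S = - S by rewrite (_ : S = 0) ?mulr0//; lra.
rewrite {1}/S (sum_spin_flip _ C) -sumrN; apply: eq_bigr => x _.
rewrite (likelihood_flip _ tC) !ffunE uC (negPf vC) addbF addbT.
by rewrite addNb signrN mulNr.
Qed.

Lemma chi2_integrand_le_evidence u v t : (forall e, `|t e| <= 1) ->
  chi2_integrand u v t <= evidence t.
Proof.
move=> t1; rewrite /chi2_integrand.
have := norm_correlator_le u v t1; have := evidence_ge0 t1.
rewrite le_eqVlt => /predU1P[<-|Z0 NZ]; first by rewrite invr0 mulr0.
rewrite ler_pdivrMr// -expr2 -(real_normK (num_real (correlator u v t))).
by rewrite lerXn2r// ?nnegrE// ltW.
Qed.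

Lemma pairmap_path (T : Type) (V : eqType) (r : rel T) (f : T -> T -> V)
    (x : T) (s : seq T) (z : V) :
  path r x s -> z \in pairmap f x s -> exists i j, r i j /\ z = f i j.
Proof.
elim: s x => [//|y s IH] x /= /andP[rxy ps]; rewrite inE => /predU1P[->|].
  by exists x, y.
exact: IH.
Qed.

(** If the support does not connect [u] to [v], the component of [u] is saturated and the correlator
    vanishes. Otherwise the support contains a path; its couplings have square 1, so its term alone
    makes the sum at least 1, and the integrand never exceeds the evidence. *)
Lemma chi2_integrand_le_paths u v t :
  (forall e, t e = 0 \/ `|t e| = 1) ->
  chi2_integrand u v t <= evidence t *
    \sum_(p : n.-bseq 'I_n | is_path G u v p) \prod_(e in path_edges G u p) t e ^+ 2.
Proof.
move=> t01.
have t1 e : `|t e| <= 1 by case: (t01 e) => [->|->//]; rewrite normr0.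
have S0 : 0 <= \sum_(p : n.-bseq 'I_n | is_path G u v p)
    \prod_(e in path_edges G u p) t e ^+ 2.
  by apply: sumr_ge0 => p _; apply: prodr_ge0 => e _; exact: sqr_ge0.
pose r : rel 'I_n := fun i j =>
  [exists e : edge G, (val e == [set i; j]%SET) && (t e != 0)].
have [/connectP[p0 rp0 vE]|uv] := boolP (connect r u v); last first.
  rewrite /chi2_integrand (@correlator_eq0 u v t [set i | connect r u i]%SET).
  - by rewrite expr0n mul0r mulr_ge0// evidence_ge0.
  - move=> e i j eE te; have rij : r i j.
      by apply/existsP; exists e; rewrite eE eqxx.
    have rji : r j i by apply/existsP; exists e; rewrite eE finset.setUC eqxx.
    rewrite !inE; apply/idP/idP => /connect_trans; apply; exact: connect1.
  - by rewrite inE connect0.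
  - by rewrite inE.
(* Loop erasure makes the walk self-avoiding. Then [u :: p] has at most [n] entries, so [p] fits
   into [n.-bseq]. *)
case/shortenP: rp0 vE => p rp up _ vE.
have sp : (size p <= n)%N.
  by have := max_card (mem (u :: p)); rewrite (card_uniqP up) card_ord => /ltnW.
have pp : is_path G u v (Bseq sp).
  rewrite /is_path up andbT vE eqxx andbT; apply: sub_path rp => i j.
  by move=> /existsP[e /andP[/eqP eE _]]; rewrite /adj_rel -eE (valP e).
apply: le_trans (chi2_integrand_le_evidence u v t1) _.
rewrite ler_peMr ?evidence_ge0// (bigD1 (Bseq sp))//=.
rewrite big1 ?lerDl => [|e].
  by apply: sumr_ge0 => q _; apply: prodr_ge0 => e _; exact: sqr_ge0.
rewrite inE => /(pairmap_path rp)[i [j [/existsP[e' /andP[/eqP e'E te']] eE]]].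
have -> : e = e' by apply: val_inj; rewrite e'E eE.
rewrite -(real_normK (num_real _)); case: (t01 e') te' => [->|->].
  by rewrite eqxx.
by rewrite expr1n.
Qed.

(* Outside [r] the couplings have already been replaced by erasures; the factor
   [evidence (erase r t)] averages to 1 over the remaining signs. *)
Lemma sign_means_chi2_le_paths u v r t : uniq r ->
  (forall e, `|t e| <= 1) -> (forall e, e \notin r -> t e = 0 \/ `|t e| = 1) ->
  sign_means r (chi2_integrand u v) t <= evidence (erase r t) *
    \sum_(p : n.-bseq 'I_n | is_path G u v p) \prod_(e in path_edges G u p) t e ^+ 2.
Proof.
elim: r t => [|e r IH] t /=.
  move=> _ _ t01; rewrite (_ : erase [::] t = t)//.
  by apply: chi2_integrand_le_paths => e; exact: t01.
move=> /andP[er ur] t1 t01.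
apply: le_trans (sign_means_chi2_erasure u v er t1) _.
(* Setting the coupling of [e] to 0, 1 or -1 makes it an erasure value, so the induction hypothesis
   on [r] applies. *)
have bound c : c = 0 \/ `|c| = 1 ->
  sign_means r (chi2_integrand u v) (update t e c) <=
  evidence (update (erase r t) e c) *
  \sum_(p : n.-bseq 'I_n | is_path G u v p)
    \prod_(e' in path_edges G u p) update t e c e' ^+ 2.
  move=> c01; rewrite -erase_update//; apply: IH => //.
    by apply: norm_update_le1 => //; case: c01 => ->; rewrite ?normr0.
  move=> e' e'r; rewrite /update; case: eqVneq => // e'e.
  by apply: t01; rewrite inE negb_or e'e.
have t2 : t e ^+ 2 <= 1.
  by rewrite -(real_normK (num_real _)) expr_le1.
have b0 := bound 0 (or_introl erefl).
have bp := bound 1 (or_intror (normr1 R)).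
have bm := bound (-1) (or_intror (normrN1 R)).
apply: le_trans (lerD (ler_wpM2l _ b0)
  (ler_wpM2l _ (ler_wpM2r _ (lerD bp bm)))) _; rewrite ?subr_ge0 ?sqr_ge0 ?invr_ge0//.
(* Path products only see squares, so 1 and -1 give the same sum, and the two evidences add up to
   twice the evidence at 0. Hence [Z] factors out. *)
rewrite (_ : \sum_(p : n.-bseq 'I_n | _) \prod_(e' in _) update t e (-1) e' ^+ 2 =
  \sum_(p : n.-bseq 'I_n | is_path G u v p)
    \prod_(e' in path_edges G u p) update t e 1 e' ^+ 2); last first.
  apply: eq_bigr => p _; apply: eq_bigr => e' _; rewrite /update.
  by case: ifP => // _; rewrite sqrrN.
rewrite -mulrDl erase_cons [evidence _ + _](_ : _ =
    2 * evidence (update (erase r t) e 0)); last first.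
  by rewrite [in RHS]evidence_update; field.
set Z := evidence _; set S1 := \sum_(p | _) \prod_(e' in _) update t e 1 e' ^+ 2.
set S0 := \sum_(p | _) _.
rewrite [leLHS](_ : _ = Z * ((1 - t e ^+ 2) * S0 + t e ^+ 2 * S1)); last by field.
rewrite le_eqVlt; apply/orP; left; apply/eqP; congr (_ * _).
rewrite /S0 /S1 !mulr_sumr -big_split/=; apply: eq_bigr => p _.
(* A path through [e] has product 0 at coupling 0, and the weight [t e ^+ 2] restores its factor at
   coupling 1. For a path avoiding [e], the weights [1 - t e ^+ 2] and [t e ^+ 2] add up to 1. *)
have [ep|ep] := boolP (e \in path_edges G u p); last first.
  have E c : \prod_(e' in path_edges G u p) update t e c e' ^+ 2 =
      \prod_(e' in path_edges G u p) t e' ^+ 2.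
    apply: eq_bigr => e' e'p; rewrite /update; case: eqP => // e'e.
    by rewrite -e'e e'p in ep.
  by rewrite !E; ring.
have E c : \prod_(e' in path_edges G u p) update t e c e' ^+ 2 =
    c ^+ 2 * \prod_(e' in path_edges G u p | e' != e) t e' ^+ 2.
  rewrite (bigD1 e)//= {1}/update eqxx; congr (_ * _).
  by apply: eq_bigr => e' /andP[_ /negPf e'e]; rewrite /update e'e.
have Et := E (t e); rewrite update_id in Et.
by rewrite Et !E; ring.
Qed.

Lemma sign_means_enum_chi2_le_paths u v t : (forall e, `|t e| <= 1) ->
  sign_means (enum {: edge G}) (chi2_integrand u v) t <=
  \sum_(p : n.-bseq 'I_n | is_path G u v p) \prod_(e in path_edges G u p) t e ^+ 2.
Proof.
move=> t1; apply: le_trans (sign_means_chi2_le_paths u v (enum_uniq _) t1 _) _.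
  by move=> e; rewrite mem_enum.
rewrite (_ : erase _ t = fun=> 0) ?evidence0 ?mul1r//.
by apply/funext => e; rewrite /erase mem_enum.
Qed.

Lemma likelihood_edge x t e : likelihood x t = likelihood x (update t e 0) +
  t e * ((-1) ^+ edge_spin x e * likelihood x (update t e 0)).
Proof.
by rewrite -{1}(update_id t e) !likelihood_updateE; ring.
Qed.

Lemma is_path_cons u v w p : is_path G u v (w :: p) =
  [&& [set u; w]%SET \in edges G, u \notin w :: p & is_path G w v p].
Proof.
rewrite /is_path /= /adj_rel; case: (_ \in edges G) => //=.
by case: (u \notin _) => /=; rewrite ?andbF.
Qed.

Lemma path_edgesP u w p e : e \in path_edges G w p -> u \notin w :: p ->
  u \notin val e.
Proof.
rewrite inE; elim: p w => [//|z p IH] w /=; rewrite !inE !negb_or.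
move=> /predU1P[->|ep] /and3P[uw uz up]; first by rewrite !inE negb_or uw.
by apply: IH ep _; rewrite inE negb_or uz.
Qed.

(** Induction from the end [u]. Without its first edge, [u] is isolated and its correlators with
    other vertices vanish. In the expansion in the first coupling, the evidence therefore keeps only
    its constant term and the correlator only its linear term, where the spins at [u] cancel and
    leave the correlator of [w] and [v]. *)
Lemma path_evidence_correlator u v p t : is_path G u v p ->
  (forall e, e \notin path_edges G u p -> t e = 0) ->
  evidence t = 1 /\ correlator u v t = \prod_(e in path_edges G u p) t e.
Proof.
elim: p u t => [|w p IH] u t.
  move=> /and3P[_ /eqP <- _] t0.
  have E0 : path_edges G u [::] = finset.set0 by apply/setP => e; rewrite !inE.
  have -> : t = fun=> 0 by apply/funext => e; rewrite t0// E0 inE.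
  rewrite E0 big_set0 evidence0; split => //.
  rewrite -[RHS](@evidence0 R n G) /correlator /evidence; congr (_ * _).
  by apply: eq_bigr => x _; rewrite addbb mul1r.
rewrite is_path_cons => /and3P[uw uwp wvp] t0.
pose e1 : edge G := exist _ [set u; w]%SET uw.
have e1p : e1 \notin path_edges G w p.
  by apply/negP => /path_edgesP /(_ uwp); rewrite !inE eqxx.
have pE : path_edges G u (w :: p) = (e1 |: path_edges G w p)%SET.
  by apply/setP => e; rewrite !inE /= -val_eqE.
pose t' := update t e1 0.
have t'0 e : e \notin path_edges G w p -> t' e = 0.
  move=> ep; rewrite /t' /update; case: eqVneq => // ee1.
  by rewrite t0// pE finset.in_setU1 negb_or ee1.
have [Z1 N1] := IH w t' wvp t'0.
have uw' : u != w by move: uwp; rewrite inE negb_or => /andP[].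
have uv : u != v.
  move/and3P: wvp => [_ /eqP <- _]; apply: contraNneq uwp => ->.
  exact: mem_last.
have sat : saturated t' [set u]%SET.
  move=> e i j eE te; have [|ep] := boolP (e \in path_edges G w p); last first.
    by rewrite t'0 ?eqxx in te.
  move=> /path_edgesP /(_ uwp); rewrite eE !inE negb_or => /andP[ui uj].
  by rewrite ![_ == u]eq_sym (negPf ui) (negPf uj).
have cor0 z : u != z -> correlator u z t' = 0.
  by move=> uz; apply: correlator_eq0 sat _ _; rewrite !inE// eq_sym.
have spin1 x : edge_spin x e1 = x u (+) x w by apply: edge_spin2.
split.
  rewrite /evidence; under eq_bigr do rewrite (likelihood_edge _ _ e1) spin1.
  rewrite big_split/= -mulr_sumr mulrDr mulrCA.
  by rewrite -/(evidence t') -/(correlator u w t') Z1 cor0// mulr0 addr0.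
rewrite pE big_setU1//= (eq_bigr t') => [|e ep]; last first.
  by rewrite /t' /update; case: eqP => // ee1; rewrite -ee1 ep in e1p.
rewrite -N1 -[LHS]/(_ * _); under eq_bigr do
  rewrite (likelihood_edge _ _ e1) spin1 mulrDr.
rewrite big_split/= mulrDr -/(correlator u v t') cor0// add0r mulrCA.
congr (_ * _); rewrite mulr_sumr; apply: eq_bigr => x _.
rewrite mulrCA; congr (_ * _); rewrite mulrA -signr_addb; congr (_ ^+ _ * _).
by rewrite addbACA addbb addFb addbC.
Qed.

End paths.

(** * Information of a pair of spins *)

Section weighted_image.
Local Open Scope ereal_scope.
Context d1 d2 (T1 : measurableType d1) (T2 : measurableType d2) (R : realType).
Variables (nu : {measure set T1 -> \bar R}) (rho : {measure set T2 -> \bar R}).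
Variables (k : T1 -> T2) (H : T1 -> R).
Hypotheses (mk : measurable_fun setT k) (mH : measurable_fun setT H)
  (H0 : forall x, (0 <= H x)%R)
  (rhoE : forall A, measurable A -> rho A = \int[nu]_(x in k @^-1` A) (H x)%:E).

Import HBNNSimple.

(** By hypothesis [rho] is the image under [k] of [nu] weighted by [H]. This settles indicators,
    linearity gives simple functions, and monotone convergence the rest. *)
Lemma ge0_integral_weighted_image (f : T2 -> \bar R) :
  measurable_fun setT f -> (forall y, 0 <= f y) ->
  \int[rho]_y f y = \int[nu]_x (f (k x) * (H x)%:E).
Proof.
move=> mf f0; pose h := nnsfun_approx measurableT mf.
have mhk n : measurable_fun setT (fun x => (h n (k x))%:E).
  by apply/measurable_EFinP; exact: measurableT_comp.
have mHE : measurable_fun setT (fun x => (H x)%:E) by apply/measurable_EFinP.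
have nd y : nondecreasing_seq (fun n => (h n y)%:E).
  by move=> a b ab; rewrite lee_fin; exact/lefP/nd_nnsfun_approx.
have cvgf y : (h n y)%:E @[n --> \oo] --> f y by exact: cvg_nnsfun_approx.
transitivity (limn (fun n => \int[rho]_y (h n y)%:E)).
  rewrite -monotone_convergence//.
  - by apply: eq_integral => y _; exact/esym/cvg_lim/cvgf.
  - by move=> n; exact/measurable_EFinP.
  - by move=> n y _; rewrite lee_fin.
transitivity (limn (fun n => \int[nu]_x ((h n (k x))%:E * (H x)%:E))); last first.
  rewrite -monotone_convergence//.
  - by apply: eq_integral => x _; apply/cvg_lim => //; apply: cvgeZr.
  - by move=> n; exact: emeasurable_funM.
  - by move=> n x _; rewrite mule_ge0 ?lee_fin.
  - by move=> x _ a b ab; rewrite lee_wpmul2r ?lee_fin//; exact: nd.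
congr (limn _); apply/funext => n.
rewrite integralT_nnsfun sintegralE.
under [RHS]eq_integral => x _.
  rewrite fimfunE -fsumEFin// ge0_mule_fsuml; last first.
    by move=> r; rewrite EFinM nnfun_muleindic_ge0.
  over.
have mind r : measurable_fun setT (fun x => (\1_(h n @^-1` [set r]) (k x) : R)).
  by apply: measurableT_comp.
rewrite ge0_integral_fsum//; last 2 first.
- move=> r; apply: emeasurable_funM => //; apply/measurable_EFinP.
  exact: measurable_funM.
- by move=> r x _; rewrite mule_ge0// ?lee_fin// -lee_fin EFinM nnfun_muleindic_ge0.
apply: eq_fsbigr => r /[!inE] -[y _ <-].
rewrite rhoE; last exact: measurable_funPTI.
under [RHS]eq_integral do rewrite EFinM -muleA.
rewrite ge0_integralZl ?lee_fin//; last 2 first.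
- by apply: emeasurable_funM => //; exact/measurable_EFinP.
- by move=> x _; rewrite mule_ge0 ?lee_fin.
congr (_ * _); rewrite integral_mkcond; apply: eq_integral => x _.
rewrite patchE indicE [x \in _](_ : _ = (k x \in h n @^-1` [set h n y]))//.
by case: (_ \in _); rewrite ?mul1e ?mul0e.
Qed.

End weighted_image.

(** * Laws on pairs of bits *)

Section bool_pairs.
Context (R : realType).
Local Open Scope ereal_scope.
Implicit Types (A : set (bool * bool)) (z : bool * bool).

Lemma set1_pair (T1 T2 : Type) (z : T1 * T2) : [set z] = [set z.1] `*` [set z.2].
Proof.
by case: z => a b; apply/seteqP; split => [_ -> //|[c e] [/= -> ->]].
Qed.

Lemma measurable_bool_pairs A : measurable A.
Proof.
apply: countable_measurable => [z|]; first by rewrite set1_pair; exact: measurableX.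
exact: countableP.
Qed.

Lemma bool_pairsE A : A = \big[setU/set0]_(z <- enum {: bool * bool} | z \in A) [set z].
Proof.
apply/seteqP; split => [z Az|z].
  by rewrite -bigcup_seq_cond; exists z => //=; rewrite mem_enum mem_set.
by rewrite -bigcup_seq_cond => -[z' /= /andP[_ /set_mem Az'] ->].
Qed.

Lemma ge0_integral_bool_pairs (mu : {measure set (bool * bool) -> \bar R})
    (f : bool * bool -> \bar R) : (forall z, 0 <= f z) ->
  \int[mu]_z f z = \sum_(z : bool * bool) f z * mu [set z].
Proof.
move=> f0; rewrite {1}(bool_pairsE setT) (eq_bigl predT) => [|z]; last first.
  by rewrite in_setT.
rewrite ge0_integral_bigsetU//=.
- rewrite big_enum; apply: eq_bigr => z _.
  rewrite (eq_integral (cst (f z))) => [|_ /set_mem -> //].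
  by rewrite integral_cst//; exact: measurable_bool_pairs.
- by move=> z; exact: measurable_bool_pairs.
- exact: enum_uniq.
- by move=> z z' _ _ [_ [-> ->]].
- by move=> _ B _; exact: measurable_bool_pairs.
Qed.

Lemma measure_bool_pairs (mu : {measure set (bool * bool) -> \bar R}) A :
  mu A = \sum_(z : bool * bool | z \in A) mu [set z].
Proof.
transitivity (\int[mu]_z (\1_A z)%:E).
  by rewrite integral_indic ?setIT//; exact: measurable_bool_pairs.
rewrite ge0_integral_bool_pairs; last by move=> z; rewrite lee_fin.
rewrite [RHS]big_mkcond/=; apply: eq_bigr => z _; rewrite indicE.
by case: (_ \in _); rewrite ?mul1e ?mul0e.
Qed.

Variable nu : probability (bool * bool)%type R.

Definition marginal_product z : R :=
  fine (distribution nu fst [set z.1]) * fine (distribution nu snd [set z.2]).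

(** At an atom of positive product mass the Radon-Nikodym derivative must be the ratio of the
    masses. At the other atoms the weight 0 kills both its value and the conventional value of a
    division by 0. *)
Lemma chi2_info_bool : chi2_info nu =
  (\sum_z ((fine (nu [set z]) / marginal_product z - 1) ^+ 2 *
           marginal_product z)%R)%:E.
Proof.
pose mu : probability (bool * bool)%type R :=
  distribution nu fst \x distribution nu snd.
rewrite /chi2_info -/mu; set g := Radon_Nikodym _ _.
have muE z : mu [set z] = (marginal_product z)%:E.
  transitivity (distribution nu fst [set z.1] * distribution nu snd [set z.2]).
    by rewrite set1_pair; exact: product_measure1E.
  by rewrite EFinM !fineK ?fin_num_measure.
(* An atom of product mass 0 has a null marginal, and each marginal bounds the mass of the atom. *)
have numu : charge_of_finite_measure nu `<< mu.
  apply/null_content_dominatesP => A _ muA.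
  rewrite [LHS]measure_bool_pairs big1// => z zA.
  have : mu [set z] = 0.
    apply/eqP; rewrite eq_le measure_ge0 andbT -muA le_measure ?inE//;
      try exact: measurable_bool_pairs.
    by move=> _ ->; exact: set_mem.
  rewrite muE => -[/eqP]; rewrite mulf_eq0.
  have le1 (h : {mfun (bool * bool)%type >-> bool}) :
      fine (distribution nu h [set h z]) == 0%R -> nu [set z] = 0.
    rewrite fine_eq0 ?fin_num_measure// => /eqP h0.
    apply/eqP; rewrite eq_le measure_ge0 andbT -h0 le_measure ?inE//;
      try exact: measurable_bool_pairs.
    by move=> _ ->.
  by move=> /orP[/(le1 fst)|/(le1 snd)].
rewrite ge0_integral_bool_pairs => [|z]; last exact: sqre_ge0.
rewrite -sumEFin; apply: eq_bigr => z _.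
rewrite [X in _ * X](_ : _ = (marginal_product z)%:E); last exact: muE.
have [->|mz0] := eqVneq (marginal_product z) 0%R; first by rewrite mulr0 mule0.
have gz : g z \is a fin_num by exact: Radon_Nikodym_fin_num.
have nuz : nu [set z] = g z * (marginal_product z)%:E.
  have := @Radon_Nikodym_integral _ _ _ (charge_of_finite_measure nu) mu [set z].
  move=> /(_ numu (measurable_bool_pairs _)) nuz; apply: etrans nuz _.
  rewrite (eq_integral (cst (g z))) => [|_ /set_mem -> //].
  rewrite integral_cst; last exact: measurable_bool_pairs.
  by congr (_ * _); exact: muE.
have /(congr1 fine) := nuz; rewrite -{1}(fineK gz) -EFinM /= => nuzr.
rewrite -[in LHS](fineK gz) -EFinB -!EFinM -expr2.
congr (((_ - _) ^+ 2 * _)%R)%:E; apply/(canRL (mulfK mz0)); exact/esym/nuzr.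
Qed.

End bool_pairs.

Section measurable_inverse.
Context (R : realType).

Lemma measurable_inv : measurable_fun setT (fun x : R => x^-1).
Proof.
(* The power with exponent -1 is the inverse on nonnegative bases, hence its application to the
   square. The outer factor [x] gives the right value 0 at 0. *)
rewrite (_ : (fun x : R => x^-1) = (fun x => x * (x ^+ 2) `^ (-1))).
  apply: measurable_funM => //.
  apply: (measurableT_comp (f := fun y : R => y `^ (-1))).
    exact: measurable_powR.
  exact: measurable_funX.
apply/funext => x; rewrite powR_inv1 ?sqr_ge0//.
have [->|x0] := eqVneq x 0; first by rewrite invr0 mul0r.
by field.
Qed.

Lemma measurable_div d (T : measurableType d) (f g : T -> R) :
  measurable_fun setT f -> measurable_fun setT g ->
  measurable_fun setT (fun x => f x / g x).
Proof.
move=> mf mg; apply: measurable_funM => //.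
exact: (measurableT_comp measurable_inv mg).
Qed.

End measurable_inverse.

(** * Correlated pairs of signs *)

Section spin_pairs.
Context (R : realType).
Local Open Scope ereal_scope.

(** The law of two uniform signs whose product has mean [h]. *)
Definition spin_pair_mass (h : R) (z : bool * bool) : R :=
  (1 + (-1) ^+ (z.1 (+) z.2) * h) / 4.

Lemma sum_bool_pairs (V : nmodType) (F : bool * bool -> V) :
  (\sum_z F z = (F (true, true) + F (true, false)) +
               (F (false, true) + F (false, false)))%R.
Proof.
rewrite (eq_bigr (fun z => F (z.1, z.2))) => [|[]//].
rewrite -(pair_bigA _ (fun a b => F (a, b)))/=.
by rewrite big_bool !big_bool.
Qed.

(** Both marginals are uniform, so the density relative to their product is [1 + h] or [1 - h], and
    its squared deviation from 1 is constant. *)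
Lemma chi2_info_spin_pair (nu : probability (bool * bool)%type R) h :
  (forall z, nu [set z] = (spin_pair_mass h z)%:E) -> chi2_info nu = (h ^+ 2)%:E.
Proof.
move=> nuE.
have nuD A : nu A = (\sum_(z : bool * bool)
    if z \in A then spin_pair_mass h z else 0)%R%:E.
  rewrite [LHS]measure_bool_pairs -sumEFin [LHS]big_mkcond/=.
  by apply: eq_bigr => z _; case: ifP => // _; rewrite nuE.
have inE' (k : bool * bool -> bool) a z : (z \in k @^-1` [set a]) = (k z == a).
  by apply/idP/eqP => [/set_mem//|kz]; exact: mem_set.
have m1 a : fine (distribution nu fst [set a]) = 2^-1%R.
  rewrite /distribution /pushforward nuD /= sum_bool_pairs !inE'.
  by rewrite /spin_pair_mass; case: a; rewrite /= ?expr0 ?expr1; lra.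
have m2 a : fine (distribution nu snd [set a]) = 2^-1%R.
  rewrite /distribution /pushforward nuD /= sum_bool_pairs !inE'.
  by rewrite /spin_pair_mass; case: a; rewrite /= ?expr0 ?expr1; lra.
rewrite chi2_info_bool; congr EFin.
under eq_bigr do rewrite nuE /marginal_product m1 m2.
by rewrite sum_bool_pairs /spin_pair_mass /= expr0 expr1; field.
Qed.

Definition spin_pair_of (z : bool * bool) : bool * bool := (z.1, z.1 (+) z.2).

Lemma measurable_spin_pair_of : measurable_fun setT spin_pair_of.
Proof. by move=> _ A _; exact: measurable_bool_pairs. Qed.

HB.instance Definition _ :=
  isMeasurableFun.Build _ _ _ _ spin_pair_of measurable_spin_pair_of.

(** For [|h| <= 1]: a fair first sign and an independent relative sign, negative with probability
    [(1 - h) / 2]. *)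
Definition spin_pair_law (h : R) : probability (bool * bool)%type R :=
  distribution (bernoulli_prob (2^-1 : R) \x bernoulli_prob ((1 - h) / 2)%R)
    spin_pair_of.

Lemma spin_pair_lawE h z : (`|h| <= 1)%R ->
  spin_pair_law h [set z] = (spin_pair_mass h z)%:E.
Proof.
rewrite ler_norml => /andP[h1 h2].
have bernE (p : R) b : (0 <= p <= 1)%R ->
    bernoulli_prob p [set b] = (bernoulli_pmf p b)%:E.
  by move=> p01; rewrite /bernoulli_prob p01 fsbig_set1.
rewrite [LHS](_ : _ = (bernoulli_prob (2^-1 : R) \x
    bernoulli_prob ((1 - h) / 2)%R) ([set z.1] `*` [set z.1 (+) z.2])).
  rewrite product_measure1E//= !bernE; try (apply/andP; split; lra).
  rewrite -EFinM /bernoulli_pmf /spin_pair_mass; congr EFin.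
  by case: z => -[] [] /=; rewrite ?expr0 ?expr1; field.
suff E : spin_pair_of @^-1` [set z] = [set z.1] `*` [set z.1 (+) z.2].
  by rewrite -E.
case: z => a b; apply/seteqP; split=> -[c e] /=; rewrite /spin_pair_of /=.
  by move=> [<- <-]; rewrite addbA addbb.
by move=> [-> ->]; rewrite addbA addbb.
Qed.

End spin_pairs.

(** * Conditional information from the posterior correlation *)

Section conditional_spin_pair.
Local Open Scope ereal_scope.
Context (R : realType) d (Omega : measurableType d) (P : probability Omega R).
Context d3 (T3 : measurableType d3).
Variables (A B : {RV P >-> bool}) (C : {RV P >-> T3}) (h : T3 -> R).
Hypotheses (mh : measurable_fun setT h) (h1 : forall c, (`|h c| <= 1)%R).
Hypothesis jointE : forall a b E, measurable E ->
  P (A @^-1` [set a] `&` B @^-1` [set b] `&` C @^-1` E) =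
  \int[distribution P C]_(c in E) (spin_pair_mass (h c) (a, b))%:E.

Lemma pair_RV_preimage a b :
  pair_RV A B @^-1` [set (a, b)] = A @^-1` [set a] `&` B @^-1` [set b].
Proof.
apply/seteqP; split=> w /=; first by move=> [<- <-].
by rewrite /pair_RV => -[-> ->].
Qed.

Lemma spin_pair_mass_bound (c : R) z : (`|c| <= 1)%R ->
  (0 <= spin_pair_mass c z <= 1)%R.
Proof.
rewrite ler_norml /spin_pair_mass => /andP[? ?].
by case: (_ (+) _); rewrite ?expr0 ?expr1; apply/andP; split; lra.
Qed.

Lemma measurable_spin_pair_mass z :
  measurable_fun setT (fun c => spin_pair_mass (h c) z).
Proof.
apply: measurable_funM => //; apply: measurable_funD => //.
exact: measurable_funM.
Qed.

(** Serves to compare the integrals for two versions of the conditional law. The finite formula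
    expresses the information through finitely many masses of the kernel. *)
Lemma measurable_chi2_info_kernel (kappa : T3 -> probability (bool * bool)%type R) :
  (forall D, measurable D -> measurable_fun setT (kappa ^~ D)) ->
  measurable_fun setT (fun c => chi2_info (kappa c)).
Proof.
move=> mk.
have mfk D : measurable_fun setT (fun c => fine (kappa c D)).
  apply: measurableT_comp; first exact: fine_measurable.
  exact: (mk _ (measurable_bool_pairs _)).
under eq_fun do rewrite chi2_info_bool.
apply/measurable_EFinP; apply: measurable_sum => z.
have mm : measurable_fun setT (fun c => marginal_product (kappa c) z).
  by apply: measurable_funM; exact: mfk.
apply: measurable_funM => //; apply: measurable_funX.
by apply: measurable_funB => //; exact: measurable_div.
Qed.

Lemma spin_pair_law_conditional :
  is_conditional_law (pair_RV A B) C (fun c => spin_pair_law (h c)).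
Proof.
have lawE c D : spin_pair_law (h c) D =
    \sum_(z : bool * bool | z \in D) (spin_pair_mass (h c) z)%:E.
  by rewrite measure_bool_pairs; apply: eq_bigr => z _; exact: spin_pair_lawE.
have mmass z : measurable_fun setT (fun c => (spin_pair_mass (h c) z)%:E).
  by apply/measurable_EFinP; exact: measurable_spin_pair_mass.
split=> [D _|D E _ mE].
  under eq_fun do rewrite lawE -big_filter.
  exact: emeasurable_sum.
have mCE : measurable (C @^-1` E) by exact: measurable_funPTI.
rewrite [LHS](_ : _ = pushforward (mrestr P mCE) (pair_RV A B) D)//.
rewrite measure_bool_pairs.
under [RHS]eq_integral do rewrite lawE -big_filter.
rewrite ge0_integral_sum//; last 2 first.
- by move=> z; exact: measurable_funTS.
- by move=> z c _; rewrite lee_fin; case/andP: (spin_pair_mass_bound z (h1 c)).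
rewrite big_filter; apply: eq_bigr => -[a b] _.
by rewrite -jointE// -pair_RV_preimage.
Qed.

(** One version of the conditional law is explicit. Any other agrees with it almost everywhere at
    each of the four atoms, hence at all of them at once, so the expectation is the same. *)
Lemma cond_chi2_info_spin_pair :
  cond_chi2_info A B C = \int[distribution P C]_c (h c ^+ 2)%:E.
Proof.
have mmass z : measurable_fun setT (fun c => (spin_pair_mass (h c) z)%:E).
  by apply/measurable_EFinP; exact: measurable_spin_pair_mass.
apply: xget_unique.
  exists (fun c => spin_pair_law (h c)); split; first exact: spin_pair_law_conditional.
  apply: eq_integral => c _; apply/esym/chi2_info_spin_pair => z.
  exact: spin_pair_lawE.
move=> _ [kappa [[mk kE] ->]].
apply: ae_eq_integral => //.
- exact: measurable_chi2_info_kernel.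
- by apply/measurable_EFinP; exact: measurable_funX.
have kz z : ae_eq (distribution P C) setT (fun c => (spin_pair_mass (h c) z)%:E)
    (fun c => kappa c [set z]).
  apply: integral_ae_eq => //.
  - apply: measurable_bounded_integrable => //.
    + by rewrite (@le_lt_trans _ _ 1)// ?probability_le1// ltry.
    + exact: measurable_spin_pair_mass.
    + exists 1%R; split => // x x1 c _ /=.
      have /andP[m0 m1] := spin_pair_mass_bound z (h1 c).
      by rewrite ger0_norm// (le_trans m1)// ltW.
  - exact: (mk _ (measurable_bool_pairs _)).
  - move=> E _ mE; case: z => a b; rewrite -jointE//.
    rewrite -pair_RV_preimage -kE//; exact: measurable_bool_pairs.
have kall : \forall c \ae distribution P C, forall z : bool * bool,
    (spin_pair_mass (h c) z)%:E = kappa c [set z].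
  by apply: filter_forall => z; apply: filterS (kz z) => c; exact.
apply: filterS kall => c kc _.
by apply: chi2_info_spin_pair => z; exact/esym/kc.
Qed.

End conditional_spin_pair.

(** * Symmetric channels and their products *)

Section channel_mean.
Local Open Scope ereal_scope.
Context (R : realType) d (Z : measurableType d) (q : bool -> probability Z R).

Definition channel_mean : set Z -> \bar R :=
  mscale ((2^-1 : R)%:nng)%R (measure_add (q false) (q true)).

HB.instance Definition _ := Measure.on channel_mean.

Lemma channel_meanE A : channel_mean A = (2^-1)%R%:E * (q false A + q true A).
Proof. by congr (_ * _); exact: measure_addE. Qed.

Let channel_mean_setT : channel_mean [set: Z] = 1.
Proof.
rewrite channel_meanE; transitivity ((2^-1)%R%:E * (1 + 1 : \bar R)).
  by congr (_ * (_ + _)); exact: probability_setT.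
by rewrite -EFinD -EFinM mulVf.
Qed.

HB.instance Definition _ :=
  @Measure_isProbability.Build _ _ R channel_mean channel_mean_setT.

End channel_mean.

(** * Densities of a symmetric channel *)

Section symmetric_density.
Local Open Scope ereal_scope.
Context (R : realType) d (Z : measurableType d) (q : bool -> probability Z R).
Variable T : Z -> Z.
Hypotheses (mT : measurable_fun setT T) (TK : involutive T)
  (qT : forall A, measurable A -> q false A = q true (T @` A)).
Local Notation m := (channel_mean q : probability Z R).

Lemma involutive_image (A : set Z) : T @` A = T @^-1` A.
Proof.
apply/seteqP; split=> [_ [z Az <-]|z Az]; first by rewrite /= TK.
by exists (T z).
Qed.

Lemma involutive_preimageK (A : set Z) : T @^-1` (T @^-1` A) = A.
Proof. by apply/seteqP; split=> z /=; rewrite TK. Qed.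

Lemma symmetric_channel_preimage b A : measurable A ->
  q b (T @^-1` A) = q (~~ b) A.
Proof.
move=> mA; have mTA : measurable (T @^-1` A) by rewrite -[_ @^-1` _]setTI; exact: mT.
case: b => /=; first by rewrite qT// involutive_image.
by rewrite qT// involutive_image involutive_preimageK.
Qed.

Lemma channel_mean_preimage A : measurable A -> m (T @^-1` A) = m A.
Proof.
move=> mA; rewrite [LHS]channel_meanE [RHS]channel_meanE.
by rewrite !symmetric_channel_preimage// addeC.
Qed.

(** The densities of the two output laws relative to their mean add up to 2 almost everywhere.
    Truncation at 2 therefore changes the density only on a null set and makes the bound hold
    everywhere. *)
Lemma channel_mean_density b : exists f : Z -> R, [/\ measurable_fun setT f,
  forall z, (0 <= f z <= 2)%R &
  forall A, measurable A -> q b A = \int[m]_(z in A) (f z)%:E].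
Proof.
have dom c : q c `<< m.
  apply/null_content_dominatesP => A mA mA0.
  have : m A = (2^-1)%R%:E * (q false A + q true A) by exact: channel_meanE.
  rewrite mA0 => /esym/eqP; rewrite mule_eq0 orbC => /orP[|].
    by rewrite padde_eq0// => /andP[/eqP qf /eqP qt]; case: c.
  by rewrite eqe invr_eq0 pnatr_eq0.
have [f [f0 ff If fE]] := radon_nikodym_sigma_finite (dom b).
have [g [g0 gf Ig gE]] := radon_nikodym_sigma_finite (dom (~~ b)).
have [mf mg] := (measurable_int _ If, measurable_int _ Ig).
have fg : ae_eq m setT (f \+ g) (cst 2%:E).
  apply: integral_ae_eq => //; first exact: integrableD.
  move=> E _ mE; rewrite ge0_integralD//; [|exact: measurable_funTS..].
  rewrite -fE// -gE// integral_cst//.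
  transitivity (2%:E * ((2^-1)%R%:E * (q false E + q true E))); last first.
    by congr (_ * _); exact/esym/channel_meanE.
  rewrite muleA -EFinM divff// mul1e.
  by case: b {fE gE f0 g0 ff gf If Ig mf mg f g} => //=; rewrite addeC.
have mk : measurable_fun setT (fun z => Num.min (fine (f z)) 2%R).
  apply: measurable_minr => //.
  by apply: measurableT_comp; [exact: fine_measurable|exact: mf].
exists (fun z => Num.min (fine (f z)) 2%R); split=> //.
  by move=> z; rewrite le_min ge_min lexx orbT andbT fine_ge0 ?ler0n.
move=> A mA; rewrite fE//; apply: ae_eq_integral => //.
- exact: measurable_funTS.
- by apply/measurable_EFinP; exact: measurable_funTS.
apply: filterS fg => z /(_ I) /= fgz _.
rewrite min_l ?fineK// -lee_fin fineK// -fgz leeDl//.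
Qed.

(** If [k] is a density of [q false], then [k \o T] is one of [q true], because [T] swaps the two
    laws and preserves their mean. Half the difference of the two is odd under [T] at every point,
    not just almost everywhere, and lies in [-1, 1] since [k] lies in [0, 2]. *)
Lemma symmetric_channel_density : exists theta : Z -> R,
  [/\ measurable_fun setT theta, forall z, (`|theta z| <= 1)%R,
      forall z, theta (T z) = (- theta z)%R &
      forall b A, measurable A ->
        q b A = \int[m]_(z in A) (1 + (-1) ^+ b * theta z)%:E].
Proof.
have [k [mk k02 kE]] := channel_mean_density false.
pose theta z : R := ((k z - k (T z)) / 2)%R.
have mkT : measurable_fun setT (k \o T) by exact: measurableT_comp.
have mth : measurable_fun setT theta.
  by apply: measurable_funM => //; exact: measurable_funB.
have th1 z : (`|theta z| <= 1)%R.
  have /andP[? ?] := k02 z; have /andP[? ?] := k02 (T z).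
  by rewrite ler_norml /theta; apply/andP; split; lra.
have msp b : measurable_fun setT (fun z => (1 + (-1) ^+ b * theta z)%R).
  by apply: measurable_funD => //; exact: measurable_funM.
have sp0 b z : (0 <= 1 + (-1) ^+ nat_of_bool b * theta z)%R by exact: spin_coupling_ge0.
have fin b A : measurable A -> q b A \is a fin_num by exact: fin_num_measure.
have kTE A : measurable A -> \int[m]_(z in A) (k (T z))%:E = q true A.
  move=> mA; have mTA : measurable (T @^-1` A) by rewrite -[_ @^-1` _]setTI; exact: mT.
  rewrite -[RHS](symmetric_channel_preimage false)// kE//.
  rewrite -[X in integral _ X _](involutive_preimageK A).
  rewrite -(@ge0_integral_pushforward _ _ _ _ _ T mT m (T @^-1` A) (EFin \o k))//.
  - by apply: eq_measure_integral => B mB _; exact: channel_mean_preimage.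
  - by apply/measurable_EFinP; exact: measurable_funTS.
  - by move=> z _; rewrite lee_fin; case/andP: (k02 z).
have mE A : measurable A -> m A = ((fine (q false A) + fine (q true A)) / 2)%:E.
  move=> mA; rewrite [LHS]channel_meanE -[q false A]fineK ?fin// -[q true A]fineK ?fin//.
  by rewrite -EFinD -EFinM mulrC.
have mEF (f : Z -> R) A : measurable_fun setT f -> measurable_fun A (fun z => (f z)%:E).
  by move=> mf; apply/measurable_EFinP; exact: measurable_funTS.
have half (f : Z -> R) A : measurable A -> measurable_fun setT f ->
    (forall z, 0 <= f z)%R ->
    (2^-1)%R%:E * \int[m]_(z in A) (f z)%:E = \int[m]_(z in A) (f z / 2)%:E.
  move=> mA mf f0; rewrite -ge0_integralZl_EFin//; last 2 first.
  - by move=> z _; rewrite lee_fin.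
  - exact: mEF.
  by apply: eq_integral => z _; rewrite -EFinM mulrC.
have k0 z : (0 <= k z)%R by case/andP: (k02 z).
have addE (f g : Z -> R) A : measurable A ->
    measurable_fun setT f -> measurable_fun setT g ->
    (forall z, 0 <= f z)%R -> (forall z, 0 <= g z)%R ->
    \int[m]_(z in A) (f z)%:E + \int[m]_(z in A) (g z)%:E =
    \int[m]_(z in A) (f z + g z)%:E.
  move=> mA mf mg f0 g0; rewrite -ge0_integralD//; try exact: mEF.
  - by move=> z _; rewrite lee_fin.
  - by move=> z _; rewrite lee_fin.
have m1 A : measurable A -> m A = \int[m]_(z in A) (1 : R)%:E.
  by move=> mA; rewrite integral_cst// mul1e.
(* The negative part of [theta] is moved to the other side, so that only nonnegative functions are
   integrated. The terms are finite and the identity is solved for the integral below. *)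
have addk A : measurable A -> \int[m]_(z in A) (1 + (-1) ^+ false * theta z)%:E +
    (2^-1)%R%:E * q true A = (2^-1)%R%:E * q false A + m A.
  move=> mA; rewrite -kTE// kE// !half// m1// !addE//.
  - by apply: eq_integral => z _; rewrite /theta; congr EFin; rewrite expr0; field.
  - exact: measurable_funM.
  - by move=> z; rewrite divr_ge0.
  - exact: measurable_funM.
  - by move=> z; rewrite divr_ge0.
exists theta; split=> //; first by move=> z; rewrite /theta TK; field.
have false_case A : measurable A ->
    q false A = \int[m]_(z in A) (1 + (-1) ^+ false * theta z)%:E.
  move=> mA; have := addk _ mA; rewrite mE//.
  rewrite -{1}[q true A]fineK ?fin// -{1 3}[q false A]fineK ?fin//.
  case: (\int[m]_(z in A) _) => [r| |]//; rewrite -!EFinM -!EFinD => -[] ?.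
  by congr EFin; lra.
case=> [|A mA]; last exact: false_case.
move=> A mA.
have : \int[m]_(z in A) (1 + (-1) ^+ true * theta z)%:E + q false A = 2%:E * m A.
  rewrite false_case// addE// m1// (_ : 2%:E = (1 + 1)%R%:E)// EFinD.
  rewrite ge0_muleDl ?lee_fin// !mul1e addE//.
  by apply: eq_integral => z _; congr EFin; rewrite expr0 expr1; ring.
rewrite mE// -{1}[q false A]fineK ?fin//.
case: (\int[m]_(z in A) _) => [r| |]//; rewrite -!EFinM -!EFinD => -[] ?.
by rewrite -[LHS]fineK ?fin//; congr EFin; lra.
Qed.

End symmetric_density.

(** * Rectangles in a product space *)

Section rectangles.
Local Open Scope ereal_scope.
Context (R : realType) (I : finType) (d : I -> measure_display)
  (Y : forall i, measurableType (d i)).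

Definition rectangle (A : forall i, set (Y i)) : set (product_space Y) :=
  [set y | forall i, A i (y i)].

Lemma measurable_rectangle (A : forall i, set (Y i)) :
  (forall i, measurable (A i)) -> measurable (rectangle A).
Proof.
move=> mA; rewrite (_ : rectangle A =
    \big[setI/setT]_(i : I) ((fun y : product_space Y => y i) @^-1` A i)).
  apply: bigsetI_measurable => i _; rewrite -[_ @^-1` _]setTI.
  exact: measurable_coordinate.
rewrite -bigcap_seq; apply/seteqP; split=> y yA i; first by move=> _; exact: yA.
by apply: yA; rewrite /= mem_index_enum.
Qed.

(** Rectangles are closed under intersection, contain the whole space, and generate the product
    sigma-algebra, a cylinder being a rectangle with all other sides full. *)
Lemma rectangle_measure_unique (m1 m2 : {measure set (product_space Y) -> \bar R}) :
  m1 setT < +oo ->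
  (forall A, (forall i, measurable (A i)) -> m1 (rectangle A) = m2 (rectangle A)) ->
  forall B, measurable B -> m1 B = m2 B.
Proof.
move=> m1oo m12 B mB.
pose rectangles : set (set (product_space Y)) :=
  [set C | exists A, (forall i, measurable (A i)) /\ C = rectangle A].
have rT : rectangles setT.
  exists (fun=> setT); split=> //.
  by apply/seteqP; split.
apply: (@measure_unique _ _ (product_space Y) rectangles (fun=> setT)) => //.
- apply/seteqP; split.
    apply: sub_sigma_algebra2 => _ [i [A [mA ->]]].
    exists (dfwith (fun j => [set: Y j]) i A); split.
      by move=> j; case: dfwithP.
    apply/seteqP; split=> y /=.
      by move=> Ay j; case: dfwithP.
    by move=> /(_ i); rewrite dfwithin.
  apply: smallest_sub; first exact: sigma_algebra_measurable.
  by move=> _ [A [mA ->]]; exact: measurable_rectangle.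
- move=> _ _ [A [mA ->]] [A' [mA' ->]]; exists (fun i => A i `&` A' i); split.
    by move=> i; exact: measurableI.
  apply/seteqP; split=> y; first by move=> [yA yA'] i; split.
  by move=> yA; split=> i; case: (yA i).
- by rewrite bigcup_const.
- by move=> _ [A [mA ->]]; exact: m12.
Qed.

Lemma prode_fin_num (J : Type) (s : seq J) (F : J -> \bar R) :
  (forall j, F j \is a fin_num) -> \prod_(j <- s) F j \is a fin_num.
Proof. by move=> Fj; elim/big_ind : _ => // x y; exact: fin_numM. Qed.

Variables (M : {measure set (product_space Y) -> \bar R})
  (rho : forall i, probability (Y i) R).
Hypothesis ME : forall A, (forall i, measurable (A i)) ->
  M (rectangle A) = \prod_i rho i (A i).

(** Induction on a list [s] of coordinates outside of which every [g i] is an indicator. With [s]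
    empty the claim is the formula for the measure of a rectangle. *)
Lemma integral_prod_coordinates (g : forall i, Y i -> R) :
  (forall i, measurable_fun setT (g i)) -> (forall i y, (0 <= g i y)%R) ->
  (forall i, \int[rho i]_y (g i y)%:E \is a fin_num) ->
  \int[M]_y (\prod_i g i (y i))%:E = \prod_i \int[rho i]_y (g i y)%:E.
Proof.
move=> mg g0 gfin.
suff H (s : seq I) : forall g : forall i, Y i -> R, 
    (forall i, measurable_fun setT (g i)) -> (forall i y, (0 <= g i y)%R) ->
    (forall i, \int[rho i]_y (g i y)%:E \is a fin_num) ->
    (forall i, i \notin s -> exists2 A, measurable A & g i = \1_A) ->
    \int[M]_y (\prod_i g i (y i))%:E = \prod_i \int[rho i]_y (g i y)%:E.
  by apply: (H (enum I)) => // i; rewrite mem_enum.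
elim: s => [|i s IH] {}g {}mg {}g0 {}gfin gs.
  have [A AP] : exists A : forall i, set (Y i),
      forall i, measurable (A i) /\ g i = \1_(A i).
    exists (fun i => sval (cid2 (gs i isT))) => i.
    by case: cid2.
  transitivity (M (rectangle A)).
    rewrite -[rectangle A]setIT -integral_indic//; last first.
      by apply: measurable_rectangle => i; case: (AP i).
    apply: eq_integral => y _; congr EFin; rewrite indicE.
    have [/set_mem yA|yA] := boolP (y \in rectangle A).
      apply: big1 => i _; have [_ ->] := AP i.
      by rewrite indicE mem_set.
    have [i] : exists i, ~ A i (y i).
      by apply/existsNP => yA'; move/negP: yA; apply; exact: mem_set.
    move=> yAi; rewrite (bigD1 i)//=; have [_ ->] := AP i.
    by rewrite indicE memNset// mul0r.
  rewrite ME => [|i]; last by case: (AP i).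
  apply: eq_bigr => i _; have [mA ->] := AP i.
  by rewrite integral_indic// setIT.
pose c := \prod_(j | j != i) \int[rho j]_y (g j y)%:E.
have c0 : 0 <= c.
  by apply: prode_ge0 => j _; apply: integral_ge0 => y _; rewrite lee_fin.
have cfin : c \is a fin_num.
  by rewrite /c -big_filter; exact: prode_fin_num.
pose H (y : product_space Y) := (\prod_(j | j != i) g j (y j))%R.
have H0 (y : product_space Y) : (0 <= H y)%R by apply: prodr_ge0 => j _; exact: g0.
have mco j : measurable_fun setT (fun y : product_space Y => g j (y j)).
  exact: (measurableT_comp (mg j) (@measurable_coordinate _ _ Y j)).
have mH : measurable_fun setT (H : product_space Y -> R).
  rewrite (_ : H = fun y : product_space Y =>
      (\prod_(j <- [seq j <- index_enum I | j != i]) g j (y j))%R).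
    by apply: measurable_prod => j _; exact: mco.
  by apply/funext => y; rewrite /H big_filter.
(* By the induction hypothesis with [g i] replaced by an indicator, coordinate [i] under [M]
   weighted by [H] has law [c] times [rho i]. The change of variables then integrates [g i]. *)
pose nu : {measure set (Y i) -> \bar R} := mscale (NngNum (fine_ge0 c0)) (rho i).
have nuE A : measurable A ->
    nu A = \int[M]_(y in (fun y : product_space Y => y i) @^-1` A) (H y)%:E.
  move=> mA; pose g' := dfwith g i (\1_A : Y i -> R).
  have g'i : g' i = \1_A by exact: dfwithin.
  have g'j j : j != i -> g' j = g j by move=> ji; apply: dfwithout; rewrite eq_sym.
  have IHg' := IH g'; transitivity (c * rho i A).
    by rewrite -[in RHS](fineK cfin).
  rewrite integral_mkcond (eq_integral (fun y : product_space Y =>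
    (\prod_j g' j (y j))%:E)); last first.
    move=> y _; rewrite patchE (bigD1 i)//= g'i.
    rewrite (eq_bigr (fun j => g j (y j))) => [|j ji]; last by rewrite g'j.
    rewrite indicE; have [/set_mem yA|yA] := boolP (y i \in A).
      by rewrite mem_set// mul1r.
    by rewrite memNset ?mul0r// => yA'; move/negP: yA; apply; exact: mem_set.
  rewrite IHg'.
  - rewrite (bigD1 i)//= g'i integral_indic// setIT muleC; congr (_ * _).
    by apply: eq_bigr => j ji; rewrite g'j.
  - by move=> j; rewrite /g'; case: dfwithP.
  - move=> j; rewrite /g'; case: dfwithP => [y|k _ y //].
    by rewrite indicE.
  - move=> j; rewrite /g'; case: dfwithP => //.
    by rewrite integral_indic// setIT; exact: fin_num_measure.
  - move=> j; rewrite /g'; case: dfwithP => [_|k ik ks]; first by exists A.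
    by apply: gs; rewrite inE eq_sym negb_or ik.
rewrite (eq_integral (fun y : product_space Y => (g i (y i))%:E * (H y)%:E)).
  rewrite -(ge0_integral_weighted_image (rho := nu)
    (@measurable_coordinate _ _ Y i) mH H0 nuE (f := EFin \o g i)); last 2 first.
  - exact/measurable_EFinP.
  - by move=> y; rewrite lee_fin.
  rewrite ge0_integral_mscale//; last 2 first.
  - exact/measurable_EFinP.
  - by move=> y _; rewrite lee_fin.
  by rewrite /= fineK// [RHS](bigD1 i)//= muleC.
by move=> y _; rewrite (bigD1 i)//= EFinM.
Qed.

End rectangles.

(** * Reversing one coordinate *)

Section coordinate_flip.
Local Open Scope ereal_scope.
Context (R : realType) (I : finType) (d : I -> measure_display)
  (Y : forall i, measurableType (d i)) (q : forall i, bool -> probability (Y i) R).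
Variable T : forall i, Y i -> Y i.
Hypotheses (mT : forall i, measurable_fun setT (@T i))
  (TK : forall i, involutive (@T i))
  (qT : forall i A, measurable A -> q i false A = q i true (@T i @` A)).

Definition flip i (y : product_space Y) : product_space Y :=
  fun j => if j == i then T (y j) else y j.

Lemma measurable_flip i : measurable_fun setT (flip i).
Proof.
apply: measurable_fun_product_space => j; rewrite /flip.
have mj := @measurable_coordinate _ _ Y j.
by case: (j == i) => //; exact: measurableT_comp.
Qed.

HB.instance Definition _ i :=
  isMeasurableFun.Build _ _ _ _ (flip i) (measurable_flip i).

Lemma flip_preimage_rectangle i (A : forall i, set (Y i)) :
  flip i @^-1` rectangle A =
  rectangle (fun j => if j == i then @T j @^-1` A j else A j).
Proof.
by apply/seteqP; split=> y yA j; have := yA j; rewrite /flip; case: (j == i).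
Qed.

Lemma measurable_flip_preimage i (A : forall i, set (Y i)) :
  (forall i, measurable (A i)) ->
  forall j, measurable (if j == i then @T j @^-1` A j else A j).
Proof.
move=> mA j; case: ifP => // _.
by rewrite -[_ @^-1` _]setTI; exact: mT.
Qed.

(* The product of the channel means is the output law of the all-plus input
   averaged over the symmetries of the coordinates, which spares a general
   construction of finite product measures. *)
Lemma product_mean_exists (P0 : probability (product_space Y) R) :
  (forall A, (forall i, measurable (A i)) ->
    P0 (rectangle A) = \prod_i q i false (A i)) ->
  exists M : probability (product_space Y) R,
  forall A, (forall i, measurable (A i)) ->
    M (rectangle A) = \prod_i channel_mean (q i) (A i).
Proof.
move=> P0E.
suff H (r : seq I) : uniq r ->
    exists M : probability (product_space Y) R,
    forall A, (forall i, measurable (A i)) ->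
    M (rectangle A) =
      \prod_i if i \in r then channel_mean (q i) (A i) else q i false (A i).
  have [M ME] := H _ (enum_uniq I); exists M => A mA.
  by rewrite ME//; apply: eq_bigr => i _; rewrite mem_enum.
elim: r => [_|i r IH /= /andP[ir ur]]; first by exists P0 => A mA; exact: P0E.
have [M ME] := IH ur.
pose Mflip : probability (product_space Y) R := distribution M (flip i).
(* The reversal at [i] swaps the two output laws of that channel, so averaging with it turns the
   factor [q i false] into the channel mean. *)
exists (channel_mean (fun b => if b then Mflip else M)) => A mA.
transitivity ((2^-1)%R%:E * (M (rectangle A) + M (flip i @^-1` rectangle A))).
  exact: channel_meanE.
rewrite flip_preimage_rectangle !ME//; last exact: measurable_flip_preimage.
rewrite (bigD1 i)//= [X in _ + X](bigD1 i)//= [RHS](bigD1 i)//=.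
rewrite (negPf ir) eqxx inE eqxx /= channel_meanE.
rewrite (symmetric_channel_preimage (@mT i) (TK (i := i)) (@qT i))//=.
set K := \prod_(j | _) _.
rewrite [X in _ + _ * X](_ : _ = K); last first.
  by apply: eq_bigr => j /negPf ->.
rewrite [X in _ = _ * X](_ : _ = K); last first.
  by apply: eq_bigr => j /negPf ji; rewrite inE ji.
by rewrite -ge0_muleDl ?muleA.
Qed.

Variable M : probability (product_space Y) R.
Hypothesis ME : forall A, (forall i, measurable (A i)) ->
  M (rectangle A) = \prod_i channel_mean (q i) (A i).

(** The image of [M] under the reversal agrees with [M] on rectangles, since each channel mean is
    invariant under its symmetry. *)
Lemma integral_flip i (f : product_space Y -> \bar R) :
  measurable_fun setT f -> (forall y, 0 <= f y) ->
  \int[M]_y f (flip i y) = \int[M]_y f y.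
Proof.
move=> mf f0; transitivity (\int[distribution M (flip i)]_y f y).
  by rewrite ge0_integral_distribution.
apply: eq_measure_integral => B mB _.
pose Mflip : probability (product_space Y) R := distribution M (flip i).
apply: (@rectangle_measure_unique _ _ _ _ Mflip M) => //.
  by rewrite [X in X < _](probability_setT Mflip) ltry.
move=> A mA; rewrite [LHS]/(M (flip i @^-1` rectangle A)).
rewrite flip_preimage_rectangle [RHS](ME mA).
rewrite [LHS](ME (measurable_flip_preimage i mA)).
apply: eq_bigr => j _; case: ifP => // _.
exact: (channel_mean_preimage (@mT j) (TK (i := j)) (@qT j)).
Qed.

Variable theta : forall i, Y i -> R.
Hypotheses (mtheta : forall i, measurable_fun setT (@theta i))
  (theta1 : forall i (y : Y i), (`|theta y| <= 1)%R)
  (thetaE : forall i b A, measurable A ->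
     q i b A = \int[channel_mean (q i)]_(y in A) (1 + (-1) ^+ b * theta y)%:E).

(** Both sides are measures in [B], so rectangles suffice; there the integral factorises over the
    coordinates and [thetaE] evaluates each factor. *)
Lemma product_density (s : I -> bool) (Ps : probability (product_space Y) R) :
  (forall A, (forall i, measurable (A i)) ->
    Ps (rectangle A) = \prod_i q i (s i) (A i)) ->
  forall B, measurable B ->
  Ps B = \int[M]_(y in B) (\prod_i (1 + (-1) ^+ s i * theta (y i)))%:E.
Proof.
move=> PsE.
pose w (y : product_space Y) := (\prod_i (1 + (-1) ^+ s i * theta (y i)))%R.
have mspin i : measurable_fun setT (fun y : Y i => (1 + (-1) ^+ s i * theta y)%R).
  by apply: measurable_funD => //; exact: measurable_funM.
have spin0 i (y : Y i) : (0 <= 1 + (-1) ^+ s i * theta y)%R by exact: spin_coupling_ge0.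
have w0 y : 0 <= (w y)%:E by rewrite lee_fin; exact: prodr_ge0.
have mw : measurable_fun setT (fun y => (w y)%:E).
  apply/measurable_EFinP; apply: measurable_prod => i _.
  exact: (measurableT_comp (mspin i) (@measurable_coordinate _ _ Y i)).
have nu0 : \int[M]_(y in set0) (w y)%:E = 0 by rewrite integral_set0.
have nuge0 B : 0 <= \int[M]_(y in B) (w y)%:E by exact: integral_ge0.
have nuadd := @semi_sigma_additive_nng_induced _ _ _ M _ mw w0.
pose nu : {measure set (product_space Y) -> \bar R} :=
  HB.pack (fun B => \int[M]_(y in B) (w y)%:E)
    (isMeasure.Build _ _ _ (fun B => \int[M]_(y in B) (w y)%:E) nu0 nuge0 nuadd).
apply: (@rectangle_measure_unique _ _ _ _ Ps nu).
  by rewrite [X in X < _](probability_setT Ps) ltry.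
move=> A mA; rewrite [LHS](PsE A mA).
pose g i (y : Y i) : R := (\1_(A i) y * (1 + (-1) ^+ s i * theta y))%R.
have gE i : \int[channel_mean (q i)]_y (g i y)%:E = q i (s i) (A i).
  rewrite thetaE// [RHS]integral_mkcond; apply: eq_integral => y _.
  by rewrite patchE /g indicE; case: (_ \in _); rewrite ?mul1r ?mul0r.
transitivity (\int[M]_y (\prod_i g i (y i))%:E).
  rewrite (integral_prod_coordinates (rho := fun i => channel_mean (q i)))//.
  - by apply: eq_bigr => i _; rewrite gE.
  - by move=> i; apply: measurable_funM => //.
  - by move=> i y; rewrite mulr_ge0// indicE.
  - by move=> i; rewrite gE; exact: fin_num_measure.
rewrite [RHS]integral_mkcond; apply: eq_integral => y _.
rewrite patchE; have [/set_mem yA|yA] := boolP (y \in rectangle A).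
  by congr EFin; apply: eq_bigr => i _; rewrite /g indicE mem_set ?mul1r.
have [i yAi] : exists i, ~ A i (y i).
  by apply/existsNP => yA'; move/negP: yA; apply; exact: mem_set.
by rewrite (bigD1 i)//= /g indicE memNset// !mul0r.
Qed.

End coordinate_flip.

Section measurable_ising.
Context (R : realType) (n : nat) (G : sgraph n).
Context d (S : measurableType d) (t : S -> edge G -> R).
Hypothesis mt : forall e, measurable_fun setT (t ^~ e).

Lemma measurable_likelihood x :
  measurable_fun setT (fun s => likelihood x (t s)).
Proof.
apply: measurable_prod => e _; apply: measurable_funD => //.
exact: measurable_funM.
Qed.

Lemma measurable_evidence : measurable_fun setT (fun s => evidence (t s)).
Proof.
apply: measurable_funM => //; apply: measurable_sum => x.
exact: measurable_likelihood.
Qed.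

Lemma measurable_correlator u v :
  measurable_fun setT (fun s => correlator u v (t s)).
Proof.
apply: measurable_funM => //; apply: measurable_sum => x.
by apply: measurable_funM => //; exact: measurable_likelihood.
Qed.

Lemma measurable_chi2_integrand u v :
  measurable_fun setT (fun s => chi2_integrand u v (t s)).
Proof.
apply: measurable_div; last exact: measurable_evidence.
by apply: measurable_funX; exact: measurable_correlator.
Qed.

End measurable_ising.

(** * Joint law of two spins *)

Section joint_mass.
Context (R : realFieldType) (n : nat) (G : sgraph n).
Implicit Types (t : edge G -> R) (u v : 'I_n).

Lemma sum_spin_eq0 u t :
  \sum_(x : {ffun 'I_n -> bool}) (-1) ^+ x u * likelihood x t = 0.
Proof.
set s := \sum_(x : _) _; suff : s = - s by lra.
rewrite {1}/s (sum_spin_flip _ [set: 'I_n]%SET) -sumrN; apply: eq_bigr => x _.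
rewrite likelihood_flip => [|e i j _ _]; last by rewrite !inE.
by rewrite ffunE inE addbT signrN mulNr.
Qed.

(** The density, relative to the mean output law, of the event that the spins at [u] and [v] take
    two given values whose product is the sign [b]. *)
Definition joint_mass u v (b : bool) t : R :=
  (evidence t + (-1) ^+ b * correlator u v t) / 4.

Lemma joint_mass_ge0 u v b t : (forall e, `|t e| <= 1) ->
  0 <= joint_mass u v b t.
Proof.
move=> /(norm_correlator_le u v); rewrite ler_norml => /andP[? ?].
by rewrite divr_ge0//; case: b; rewrite ?expr0 ?expr1; lra.
Qed.

Lemma sign_mean_joint_mass u v b e t :
  sign_mean e (joint_mass u v b) t = joint_mass u v b (update t e 0).
Proof.
rewrite /joint_mass -sign_mean_evidence -sign_mean_correlator /sign_mean.
by field.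
Qed.

Lemma joint_massE u v (a b : bool) t :
  (2 ^+ n)^-1 * \sum_(x : {ffun 'I_n -> bool} | (x u == a) && (x v == b))
    likelihood x t = joint_mass u v (a (+) b) t.
Proof.
(* The indicator of two prescribed signs is the mean of four characters. Those involving a single
   spin sum to 0 by the global flip. *)
have E (x : {ffun 'I_n -> bool}) :
    (if (x u == a) && (x v == b) then likelihood x t else 0) =
    (likelihood x t + (-1) ^+ a * ((-1) ^+ x u * likelihood x t) +
     (-1) ^+ b * ((-1) ^+ x v * likelihood x t) +
     (-1) ^+ (a (+) b) * ((-1) ^+ (x u (+) x v) * likelihood x t)) / 4.
  by case: (x u) (x v) a b => [] [] [] [] /=; rewrite ?expr0 ?expr1; field.
rewrite big_mkcond; under eq_bigr do rewrite E.
rewrite -mulr_suml !big_split/= -!mulr_sumr !sum_spin_eq0.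
rewrite /joint_mass /evidence /correlator.
by field; rewrite expf_neq0.
Qed.

(** Where the evidence vanishes, so does the correlator, since it is bounded by the evidence. *)
Lemma correlator_ratioE u v t : (forall e, `|t e| <= 1) ->
  correlator u v t / evidence t * evidence t = correlator u v t.
Proof.
move=> t1; have [Z0|Z0] := eqVneq (evidence t) 0; last by rewrite divfK.
rewrite Z0 mulr0; apply/esym/eqP; rewrite -normr_le0 -Z0.
exact: norm_correlator_le.
Qed.

Lemma norm_correlator_ratio_le1 u v t : (forall e, `|t e| <= 1) ->
  `|correlator u v t / evidence t| <= 1.
Proof.
move=> t1; rewrite normrM normfV (ger0_norm (evidence_ge0 t1)).
have := norm_correlator_le u v t1; have := evidence_ge0 t1.
rewrite le_eqVlt => /predU1P[<- _|Z0 NZ]; first by rewrite invr0 mulr0.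
by rewrite ler_pdivrMr// mul1r.
Qed.

Lemma joint_mass_ratioE u v (b : bool) t : (forall e, `|t e| <= 1) ->
  (1 + (-1) ^+ b * (correlator u v t / evidence t)) / 4 * evidence t =
  joint_mass u v b t.
Proof.
by move=> t1; rewrite /joint_mass -{2}(correlator_ratioE u v t1); ring.
Qed.

Lemma chi2_integrand_ratioE u v t : (forall e, `|t e| <= 1) ->
  (correlator u v t / evidence t) ^+ 2 * evidence t = chi2_integrand u v t.
Proof.
move=> t1; rewrite /chi2_integrand -{2}(correlator_ratioE u v t1).
have [->|Z0] := eqVneq (evidence t) 0; first by rewrite invr0 !mulr0.
by field.
Qed.

Lemma chi2_integrand_path u v p t : is_path G u v p ->
  chi2_integrand u v (erase (enum (~: path_edges G u p)%SET) t) =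
  \prod_(e in path_edges G u p) t e ^+ 2.
Proof.
move=> up; set t' := erase _ t.
have [|Z1 N1] := @path_evidence_correlator R n G u v p t' up.
  by move=> e ep; rewrite /t' /erase mem_enum finset.in_setC ep.
rewrite /chi2_integrand Z1 N1 divr1 -prodrXl; apply: eq_bigr => e ep.
by rewrite /t' /erase mem_enum finset.in_setC ep.
Qed.

End joint_mass.

(** * Binary synchronization instances *)

Section synchronization.
Local Open Scope ereal_scope.
Context (R : realType) (n : nat) (G : sgraph n) (d : edge G -> measure_display)
  (Y : forall e, measurableType (d e)).
Variables (T : forall e, Y e -> Y e) (theta : forall e, Y e -> R).
Variable M : probability (product_space Y) R.
Hypotheses (mT : forall e, measurable_fun setT (@T e))
  (mtheta : forall e, measurable_fun setT (@theta e))
  (theta1 : forall e (z : Y e), (`|theta z| <= 1)%R)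
  (thetaT : forall e (z : Y e), theta (T z) = (- theta z)%R)
  (MT : forall e (f : product_space Y -> \bar R), measurable_fun setT f ->
     (forall y, 0 <= f y) -> \int[M]_y f (flip T e y) = \int[M]_y f y).

Definition couplings (y : product_space Y) : edge G -> R := fun e => theta (y e).

Lemma norm_couplings_le1 y e : (`|couplings y e| <= 1)%R.
Proof. exact: theta1. Qed.

Lemma measurable_couplings e : measurable_fun setT (couplings ^~ e).
Proof. exact: (measurableT_comp (@mtheta e) (@measurable_coordinate _ _ Y e)). Qed.

Lemma couplings_flip e y :
  couplings (flip T e y) = update (couplings y) e (- couplings y e)%R.
Proof.
by apply/funext => e'; rewrite /couplings /flip /update; case: eqVneq => // ->.
Qed.

Lemma measurable_sign_means r (F : (edge G -> R) -> R) :
  measurable_fun setT (F \o couplings) ->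
  measurable_fun setT (sign_means r F \o couplings).
Proof.
move=> mF; elim: r => [//|e r IH].
rewrite (_ : _ \o _ = fun y => ((sign_means r F \o couplings) y +
    (sign_means r F \o couplings) (flip T e y)) / 2)%R.
  apply: measurable_funM => //; apply: measurable_funD => //.
  exact: (measurableT_comp IH (measurable_flip mT e)).
by apply/funext => y; rewrite /= /sign_mean couplings_flip.
Qed.

Lemma sign_means_ge0 r (F : (edge G -> R) -> R) t :
  (forall t', (forall e, `|t' e| <= 1)%R -> (0 <= F t')%R) ->
  (forall e, `|t e| <= 1)%R -> (0 <= sign_means r F t)%R.
Proof.
move=> F0; elim: r t => [|e r IH] t t1 /=; first exact: F0.
rewrite divr_ge0// addr_ge0// IH//.
by apply: norm_update_le1; rewrite ?normrN.
Qed.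

(** Each reversal in [r] preserves [M], fixes [phi] and negates one coupling, so the integral is the
    mean of its values for the two signs. *)
Lemma integral_sign_means r (phi : product_space Y -> R)
    (F : (edge G -> R) -> R) :
  measurable_fun setT phi -> (forall y, (0 <= phi y)%R) ->
  (forall e y, e \in r -> phi (flip T e y) = phi y) ->
  measurable_fun setT (F \o couplings) ->
  (forall t, (forall e, `|t e| <= 1)%R -> (0 <= F t)%R) ->
  \int[M]_y (phi y * F (couplings y))%:E =
  \int[M]_y (phi y * sign_means r F (couplings y))%:E.
Proof.
move=> mphi phi0 phir mF F0; elim: r phir => [//|e r IH] phir.
rewrite IH => [|e' y e'r]; last by rewrite phir// inE e'r orbT.
set f := fun y => (phi y * sign_means r F (couplings y))%:E.
have f0 y : 0 <= f y.
  by rewrite lee_fin mulr_ge0// sign_means_ge0// => e'; exact: norm_couplings_le1.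
have mf : measurable_fun setT f.
  by apply/measurable_EFinP/measurable_funM => //; exact: measurable_sign_means.
have mff : measurable_fun setT (fun y => f (flip T e y)).
  exact: (measurableT_comp mf (measurable_flip mT e)).
transitivity (\int[M]_y ((2^-1)%R%:E * (f y + f (flip T e y)))).
  rewrite ge0_integralZl_EFin//; last 2 first.
  - by move=> y _; exact: adde_ge0.
  - exact: emeasurable_funD.
  rewrite ge0_integralD// MT// -/f.
  case: (\int[M]_y f y) => [s| |].
  - by rewrite -EFinD -EFinM; congr EFin; field.
  - by rewrite addye// gt0_muley ?lte_fin ?invr_gt0.
  - by rewrite addNye gt0_muleNy ?lte_fin ?invr_gt0.
apply: eq_integral => y _; rewrite /f phir ?inE ?eqxx// couplings_flip /=.
by rewrite -EFinD -EFinM; congr EFin; rewrite /sign_mean; field.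
Qed.

(** Marginalises the unobserved edges: events read off from [S] do not notice reversals outside [S],
    and averaging [F] over those signs sets the couplings to 0. *)
Lemma integral_erase (S : {set edge G}) (E : set (subproduct_space Y S))
    (F : (edge G -> R) -> R) :
  measurable E -> measurable_fun setT (F \o couplings) ->
  (forall t, (forall e, `|t e| <= 1)%R -> (0 <= F t)%R) ->
  (forall e t, sign_mean e F t = F (update t e 0%R)) ->
  \int[M]_(y in subfamily S @^-1` E) (F (couplings y))%:E =
  \int[M]_(y in subfamily S @^-1` E)
    (F (erase (enum (~: S)%SET) (couplings y)))%:E.
Proof.
move=> mE mF F0 Fe.
have mSE : measurable (subfamily S @^-1` E) by exact: measurable_funPTI.
pose phi : product_space Y -> R := \1_(subfamily S @^-1` E).
have restrictE (H : product_space Y -> R) :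
    \int[M]_(y in subfamily S @^-1` E) (H y)%:E = \int[M]_y (phi y * H y)%:E.
  rewrite integral_mkcond; apply: eq_integral => y _; rewrite patchE /phi indicE.
  by case: (_ \in _); rewrite ?mul1r ?mul0r.
rewrite !restrictE (integral_sign_means (r := enum (~: S)%SET))//.
- by apply: eq_integral => y _; rewrite sign_means_erase ?enum_uniq.
- exact: measurable_indic.
- move=> e y; rewrite mem_enum finset.in_setC => eS.
  rewrite /phi !indicE; congr (nat_of_bool _)%:R.
  have sE : subfamily S (flip T e y) = subfamily S y.
    apply: functional_extensionality_dep => -[e' e'S]; rewrite /subfamily /flip /=.
    by case: eqVneq => // e'e; rewrite -e'e e'S in eS.
  by apply/idP/idP => /set_mem h; apply/mem_set; rewrite /= ?sE// -sE.
Qed.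

Context (PGQ : {ffun 'I_n -> bool} -> probability (product_space Y) R).
Hypothesis PGQE : forall x B, measurable B ->
  PGQ x B = \int[M]_(y in B) (likelihood x (couplings y))%:E.
Context dO (Omega : measurableType dO) (P : probability Omega R)
  (X : 'I_n -> {RV P >-> bool}) (Yv : {RV P >-> product_space Y}).
Hypothesis hXY : is_synchronization_instance PGQ X Yv.

Definition configuration (w : Omega) : {ffun 'I_n -> bool} := [ffun i => X i w].

Lemma probability_configuration (K : pred {ffun 'I_n -> bool})
    (B : set (product_space Y)) : measurable B ->
  P ([set w | K (configuration w)] `&` Yv @^-1` B) =
  \int[M]_(y in B)
    ((2 ^+ n)^-1 * \sum_(x | K x) likelihood x (couplings y))%:E.
Proof.
move=> mB; have mYB : measurable (Yv @^-1` B) by exact: measurable_funPTI.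
pose A x := [set w | forall i, X i w = x i] `&` Yv @^-1` B.
have mA x : measurable (A x).
  apply: measurableI => //.
  rewrite (_ : [set w | _] = \big[setI/setT]_(i : 'I_n) (X i @^-1` [set x i])).
    by apply: bigsetI_measurable => i _; exact: measurable_funPTI.
  rewrite -bigcap_seq; apply/seteqP; split=> w wA i; first by move=> _; exact: wA.
  by apply: wA; rewrite /= mem_index_enum.
pose s := [seq x <- enum {: {ffun 'I_n -> bool}} | K x].
rewrite (_ : _ `&` _ = \bigcup_(x in [set` s]) A x); last first.
  apply/seteqP; split=> w.
    move=> [Kw Bw]; exists (configuration w).
      by rewrite /= mem_filter mem_enum Kw.
    by split=> // i; rewrite ffunE.
  move=> [x /=]; rewrite mem_filter => /andP[Kx _] [xw Bw]; split=> //=.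
  by rewrite (_ : configuration w = x)//; apply/ffunP => i; rewrite ffunE xw.
have su : uniq s by rewrite filter_uniq ?enum_uniq.
rewrite measure_fin_bigcup//; last first.
  move=> x y _ _ [w [[xw _] [yw _]]].
  by apply/ffunP => i; rewrite -xw -yw.
rewrite -fsbig_seq//.
transitivity (\sum_(x <- s) \int[M]_(y in B)
    ((2 ^+ n)^-1 * likelihood x (couplings y))%:E).
  apply: eq_bigr => x _; rewrite [LHS]hXY// PGQE// -ge0_integralZl_EFin//.
  - by move=> y _; rewrite lee_fin likelihood_ge0// => e; exact: norm_couplings_le1.
  - apply/measurable_EFinP/measurable_funTS/measurable_likelihood => e.
    exact: measurable_couplings.
rewrite -ge0_integral_sum//.
- apply: eq_integral => y _.
  by rewrite sumEFin -mulr_sumr big_filter big_enum_cond.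
- move=> x; apply/measurable_EFinP/measurable_funTS/measurable_funM => //.
  by apply: measurable_likelihood => e; exact: measurable_couplings.
- move=> x y _; rewrite lee_fin mulr_ge0 ?invr_ge0 ?exprn_ge0//.
  by rewrite likelihood_ge0// => e; exact: norm_couplings_le1.
Qed.

Section observed.
Variable S : {set edge G}.

(** An unobserved edge gets coupling 0, at which its likelihood factor is 1. *)
Definition observed_couplings (c : subproduct_space Y S) : edge G -> R :=
  fun e => oapp (fun s : {e | e \in S} => theta (c s)) 0%R (insub e).

Lemma observed_couplingsE y :
  observed_couplings (subfamily S y) = erase (enum (~: S)%SET) (couplings y).
Proof.
apply/funext => e; rewrite /observed_couplings /erase mem_enum finset.in_setC.
by case: insubP => [s -> <-|/negPf ->].
Qed.

Lemma norm_observed_couplings_le1 c e : (`|observed_couplings c e| <= 1)%R.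
Proof. by rewrite /observed_couplings; case: insubP => //= _; rewrite normr0. Qed.

Lemma measurable_observed_couplings e :
  measurable_fun setT (observed_couplings ^~ e).
Proof.
rewrite /observed_couplings; case: insubP => //= s _ _.
exact: (measurableT_comp (@mtheta (val s)) (@measurable_coordinate _ _ _ s)).
Qed.

Let Obs : {RV P >-> subproduct_space Y S} := observed Yv S.
Let Z c : R := evidence (observed_couplings c).
Let N u v c : R := correlator u v (observed_couplings c).

Let mZ : measurable_fun setT (Z : subproduct_space Y S -> R).
Proof. by apply: measurable_evidence; exact: measurable_observed_couplings. Qed.

Let mN u v : measurable_fun setT (N u v : subproduct_space Y S -> R).
Proof. by apply: measurable_correlator; exact: measurable_observed_couplings. Qed.

(** The evidence of all couplings is the density of the full output; erasing the unobserved
    couplings leaves a function of the observations. *)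
Lemma distribution_observed E : measurable E ->
  distribution P Obs E =
  \int[M]_(y in subfamily S @^-1` E) (Z (subfamily S y))%:E.
Proof.
move=> mE; have mSE : measurable (subfamily S @^-1` E) by exact: measurable_funPTI.
transitivity (P ([set w | predT (configuration w)] `&` Yv @^-1` (subfamily S @^-1` E))).
  by congr (P _); apply/seteqP; split=> w; [|case].
rewrite (probability_configuration _ mSE).
rewrite [LHS](integral_erase (F := @evidence R n G) mE).
- by apply: eq_integral => y _; rewrite /Z observed_couplingsE.
- by apply: measurable_evidence => e; exact: measurable_couplings.
- by move=> t t1; exact: evidence_ge0.
- by move=> e t; exact: sign_mean_evidence.
Qed.

Lemma ge0_integral_observed (f : subproduct_space Y S -> \bar R) :
  measurable_fun setT f -> (forall c, 0 <= f c) ->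
  \int[distribution P Obs]_c f c =
  \int[M]_y (f (subfamily S y) * (Z (subfamily S y))%:E).
Proof.
apply: ge0_integral_weighted_image; last exact: distribution_observed.
- exact: measurable_subfamily.
- exact: (measurableT_comp mZ (@measurable_subfamily _ _ _ S)).
- by move=> y; apply: evidence_ge0 => e; exact: norm_observed_couplings_le1.
Qed.

(** [N / Z] is the posterior correlation given the observations, and [Z] is their density. The mean
    square correlation is thus the integral of [N ^ 2 / Z]. *)
Lemma cond_chi2_info_observed u v :
  cond_chi2_info (X u) (X v) Obs =
  \int[M]_y (chi2_integrand u v (erase (enum (~: S)%SET) (couplings y)))%:E.
Proof.
have t1 c e := norm_observed_couplings_le1 c e.
have mh : measurable_fun setT (fun c => N u v c / Z c)%R.
  exact: measurable_div (mN u v) mZ.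
have h1 c : (`|N u v c / Z c| <= 1)%R by exact: norm_correlator_ratio_le1.
(* The density of the two prescribed signs with the full output is marginalised to [S], then split
   into conditional mass times evidence. *)
have joint a b E : measurable E ->
    P (X u @^-1` [set a] `&` X v @^-1` [set b] `&` Obs @^-1` E) =
    \int[distribution P Obs]_(c in E) (spin_pair_mass (N u v c / Z c) (a, b))%:E.
  move=> mE.
  have mSE : measurable (subfamily S @^-1` E) by exact: measurable_funPTI.
  transitivity (P ([set w | [pred x : {ffun 'I_n -> bool} |
      (x u == a) && (x v == b)] (configuration w)] `&`
      Yv @^-1` (subfamily S @^-1` E))).
    congr (P (_ `&` _)); apply/seteqP; split=> w /=; rewrite !ffunE.
      by move=> [-> ->]; rewrite !eqxx.
    by move=> /andP[/eqP -> /eqP ->].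
  rewrite (probability_configuration _ mSE).
  under eq_integral do rewrite joint_massE.
  rewrite (integral_erase (F := joint_mass u v (a (+) b)) mE).
  - rewrite [RHS]integral_mkcond ge0_integral_observed.
    + rewrite [LHS]integral_mkcond; apply: eq_integral => y _.
      rewrite !patchE [y \in _](_ : _ = (subfamily S y \in E)); last by [].
      case: (_ \in _); last by rewrite mul0e.
      rewrite -EFinM -observed_couplingsE /spin_pair_mass /=; congr EFin.
      exact/esym/joint_mass_ratioE.
    + apply/(measurable_restrictT _ mE)/measurable_funTS/measurable_EFinP.
      exact: measurable_spin_pair_mass.
    + apply: erestrict_ge0 => c _; rewrite lee_fin.
      by case/andP: (spin_pair_mass_bound (a, b) (h1 c)).
  - apply: measurable_funM; last exact: measurable_cst.
    apply: measurable_funD.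
      by apply: measurable_evidence => e; exact: measurable_couplings.
    apply: measurable_funM; first exact: measurable_cst.
    by apply: measurable_correlator => e; exact: measurable_couplings.
  - by move=> t; exact: joint_mass_ge0.
  - by move=> e t; exact: sign_mean_joint_mass.
rewrite (cond_chi2_info_spin_pair mh h1 joint) ge0_integral_observed.
- apply: eq_integral => y _; rewrite -EFinM -observed_couplingsE.
  by congr EFin; exact: chi2_integrand_ratioE.
- by apply/measurable_EFinP; exact: measurable_funX mh.
- by move=> c; rewrite lee_fin sqr_ge0.
Qed.

End observed.

Lemma cond_chi2_info_observed_le u v : u != v ->
  cond_chi2_info (X u) (X v) (observed Yv [set: edge G]%SET) <=
  \sum_(p : n.-bseq 'I_n | is_path G u v p)
     cond_chi2_info (X u) (X v) (observed Yv (path_edges G u p)).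
Proof.
move=> uv; rewrite cond_chi2_info_observed.
have -> : enum (~: [set: edge G])%SET = [::].
  by rewrite finset.setCT; apply/eqP; rewrite -size_eq0 -cardE cards0.
have chi2_ge0 t : (forall e, `|t e| <= 1)%R ->
    (0 <= @chi2_integrand R n G u v t)%R.
  by move=> t1; rewrite divr_ge0 ?sqr_ge0 ?evidence_ge0.
have mchi2 : measurable_fun setT (@chi2_integrand R n G u v \o couplings).
  by apply: measurable_chi2_integrand => e; exact: measurable_couplings.
have mpath p : measurable_fun setT
    (fun y => \prod_(e in path_edges G u p) couplings y e ^+ 2)%R.
  rewrite (_ : (fun y => _) = fun y : product_space Y =>
      (\prod_(e <- enum (path_edges G u p)) couplings y e ^+ 2)%R).
    apply: measurable_prod => e _; apply: measurable_funX.
    exact: measurable_couplings.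
  by apply/funext => y; rewrite big_enum.
have path0 p y : (0 <= \prod_(e in path_edges G u p) couplings y e ^+ 2)%R.
  by apply: prodr_ge0 => e _; exact: sqr_ge0.
under [leRHS]eq_bigr => p up.
  rewrite cond_chi2_info_observed.
  under eq_integral do rewrite chi2_integrand_path//.
  over.
rewrite -big_filter -ge0_integral_sum//; last 2 first.
- by move=> p; apply/measurable_EFinP.
- by move=> p y _; rewrite lee_fin.
(* Averaging the integrand over all coupling signs keeps the integral and makes the pointwise path
   bound available. *)
rewrite [leLHS](_ : _ =
    \int[M]_y (sign_means (enum {: edge G}) (chi2_integrand u v) (couplings y))%:E).
  apply: ge0_le_integral => //.
  - move=> y _; rewrite lee_fin; apply: sign_means_ge0; first exact: chi2_ge0.
    exact: norm_couplings_le1.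
  - by apply/measurable_EFinP; exact: (measurable_sign_means _ mchi2).
  - apply: emeasurable_sum => p; apply/measurable_EFinP; exact: mpath.
  - move=> y _; rewrite sumEFin lee_fin big_filter.
    by apply: sign_means_enum_chi2_le_paths => e; exact: norm_couplings_le1.
have := @integral_sign_means (enum {: edge G}) (cst 1%R) (@chi2_integrand R n G u v).
move=> /(_ (measurable_cst _) (fun=> ler01) (fun _ _ _ => erefl) mchi2 chi2_ge0).
under eq_integral do rewrite mul1r.
by under [in X in _ = X -> _]eq_integral do rewrite mul1r.
Qed.

End synchronization.

Theorem mainTheorem2 (R : realType) (n : nat) (G : sgraph n)
    (d : edge G -> measure_display) (Y : forall e, measurableType (d e))
    (Q : edge_channels R Y)
    (PGQ : {ffun 'I_n -> bool} -> probability (product_space Y) R)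
    (hPGQ : is_graphical_channel Q PGQ)
    (hsym : forall e, symmetric_channel (Q e))
    (dO : measure_display) (Omega : measurableType dO)
    (P : probability Omega R)
    (X : 'I_n -> {RV P >-> bool}) (Yv : {RV P >-> product_space Y})
    (hXY : is_synchronization_instance PGQ X Yv)
    (u v : 'I_n) (huv : u != v) :
  (cond_chi2_info (X u) (X v) (observed Yv [set: edge G]%SET) <=
   \sum_(p : n.-bseq 'I_n | is_path G u v p)
     cond_chi2_info (X u) (X v) (observed Yv (path_edges G u p)))%E.
Proof.
pose T e := sval (cid (hsym e)).
have mT e : measurable_fun setT (T e) by have [] := svalP (cid (hsym e)).
have TK e : involutive (T e) by have [] := svalP (cid (hsym e)).
have QT e A : measurable A -> Q e false A = Q e true (T e @` A).
  by have [_ _] := svalP (cid (hsym e)); exact.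
have density e := symmetric_channel_density (mT e) (TK e) (QT e).
pose theta e := sval (cid (density e)).
have mtheta e : measurable_fun setT (theta e) by have [] := svalP (cid (density e)).
have theta1 e z : `|theta e z| <= 1.
  by have [_ + _ _] := svalP (cid (density e)); exact.
have thetaT e z : theta e (T e z) = - theta e z.
  by have [_ _ + _] := svalP (cid (density e)); exact.
have thetaE e b A : measurable A -> Q e b A =
    (\int[channel_mean (Q e)]_(z in A) (1 + (-1) ^+ b * theta e z)%:E)%E.
  by have [_ _ _] := svalP (cid (density e)); exact.
(* The all-plus configuration gives every edge the sign +1, so its output law is the product of the
   [Q e false], from which the mean output law is built. *)
have [A mA|M ME] := @product_mean_exists _ _ _ _ Q T mT TK QT (PGQ [ffun=> false]).
  rewrite [LHS](hPGQ _ _ mA); apply: eq_bigr => e _.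
  by rewrite /edge_spin big1// => i _; rewrite ffunE.
apply: (@cond_chi2_info_observed_le _ _ _ _ _ T theta M) hXY _ _ huv => //.
- by move=> e f mf f0; apply: (integral_flip mT TK QT ME).
- move=> x B mB; apply: (product_density ME mtheta theta1 thetaE) => //.
  exact: hPGQ.
Qed.
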